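(* Let $\mu$ be a probability measure on $\mathbb{R}$, absolutely continuous with density $f$, whose support is not included in $(-\infty,0)$. Assume there is a complex valued function $k$ on $\mathbb{R}$ such that $f(t)=\int_{\mathbb{R}}e^{iut}k(u)\,du$ for all $t\ge0$, and that 1. the absolute moments $M_n=\int_{\mathbb{R}}|u|^n|k(u)|\,du$, $n\ge0$, are finite and $\limsup_n M_n/n!<\infty$; 2. $k$ does not vanish on any interval of $\mathbb{R}$. Then $f$ is bounded on $[0,\infty)$, and for every $g\in L^1([0,\infty))$, if $\int_0^\infty f(t+s)g(s)\,ds=0$ for all $t\ge0$ then $g=0$ almost everywhere. In particular, $\mu$ is characterized by the restrictions of $\mu$ and $\mu*\mu$ to $[0,\infty)$ (any probability measure $\mu_1$ on $\mathbb{R}$ with $\mu_1=\mu$ and $\mu_1*\mu_1=\mu*\mu$ on $[0,\infty)$ equals $\mu$), and $\mu\in\mathscr{C}$. Moreover the restriction of $f$ to $[0,\infty)$ admits an analytic continuation on $\mathbb{R}$ (namely $t\mapsto\int_{\mathbb{R}}e^{iut}k(u)\,du$ is real-analytic on $\mathbb{R}$).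
   Context: $\mathscr{C}$ is the set of probability measures $\mu$ on $\mathbb{R}$ such that every probability measure $\mu_1$ with $\mu_1^{*n}=\mu^{*n}$ on $[0,\infty)$ for all $n\ge1$ ($*n$ = $n$-fold convolution power) equals $\mu$.
   Formalization: Condition 2 is taken as ''k is not almost everywhere zero on any nondegenerate interval'' (read pointwise, the claim fails for k the indicator of the rationals and μ uniform on [-1,0]); k is measurable and g is real-valued (complex g reduces to real and imaginary parts). *)

(* Defs.v *)
From HB Require Import structures.
From mathcomp Require Import all_boot all_order all_algebra.
From mathcomp Require Import all_classical all_reals all_analysis.
Set Implicit Arguments. Unset Strict Implicit. Unset Printing Implicit Defensive.
Import Order.TTheory GRing.Theory Num.Theory.
Import numFieldNormedType.Exports.
Local Open Scope classical_set_scope.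
Local Open Scope ring_scope.

Definition msupport (R : realType) (mu : set R -> \bar R) : set R :=
  [set x | forall e : R, 0 < e -> (0 < mu (ball x e))%E].

Definition mconv (R : realType) (mu : set R -> \bar R)
    (nu : {measure set R -> \bar R}) : set R -> \bar R :=
  fun A => (\int[nu]_y mu [set x : R | (x + y)%R \in A])%E.

Fixpoint mconvpow (R : realType) (mu : {measure set R -> \bar R}) (n : nat)
    : set R -> \bar R :=
  match n with
  | 0 => @dirac _ R 0 R
  | m.+1 => mconv (mconvpow mu m) mu
  end.

Definition classC (R : realType) (mu : probability R R) : Prop :=
  forall mu1 : probability R R,
    (forall n : nat, (1 <= n)%N -> forall A : set R, measurable A ->
       A `<=` `[(0:R)%R, +oo[ -> mconvpow mu1 n A = mconvpow mu n A) ->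
    forall A : set R, measurable A -> mu1 A = mu A.

(* Real and imaginary parts of t |-> \int e^{iut} k(u) du, k = kr + i ki. *)
Definition fourier_re (R : realType) (kr ki : R -> R) (t : R) : \bar R :=
  (\int[lebesgue_measure]_u (cos (u * t) * kr u - sin (u * t) * ki u)%:E)%E.
Definition fourier_im (R : realType) (kr ki : R -> R) (t : R) : \bar R :=
  (\int[lebesgue_measure]_u (sin (u * t) * kr u + cos (u * t) * ki u)%:E)%E.

Definition abs_moment (R : realType) (kr ki : R -> R) (n : nat) : \bar R :=
  (\int[lebesgue_measure]_u (`|u| ^+ n * Num.sqrt (kr u ^+ 2 + ki u ^+ 2))%:E)%E.

Definition real_analytic (R : realType) (F : R -> R) : Prop :=
  forall x0 : R, exists2 r : R, 0 < r &
    exists a : nat -> R, forall x : R, `|x - x0| < r ->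
      (fun N : nat => \sum_(0 <= n < N) a n * (x - x0) ^+ n) @ \oo --> F x.

(* Main.v *)
Require Import Defs.
From HB Require Import structures.
From mathcomp Require Import all_boot all_order all_algebra.
From mathcomp Require Import all_classical all_reals all_analysis.
From mathcomp Require Import measurable_realfun.
From mathcomp Require Import ring lra.
Import Order.TTheory GRing.Theory Num.Theory.
Import numFieldNormedType.Exports.
Local Open Scope classical_set_scope.
Local Open Scope ring_scope.

(* Write F for the Fourier transform of k, so that f = F on [0, oo[.  The moment
   bound makes F(x + y) agree with a polynomial in y of degree < N up to
   C |y|^N, uniformly in x and N; hence F is analytic, and a function of this
   kind vanishing on [0, oo[ vanishes identically.

   If a finite signed measure m on [0, oo[ satisfies int F(t + s) dm(s) = 0 for
   t >= 0, Fubini turns the left-hand side into the transform of k mhat, again a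
   function of this kind.  So it is zero for all t, k mhat = 0 a.e., and since
   mhat is continuous and k vanishes on no interval, mhat = 0 and m = 0.  With
   m = g(s) ds this is the second assertion.

   For the convolution statement, restrict mu * mu to [0, oo[: the part of mu
   on [0, oo[ is known, and a sum of two negative terms is negative, so the
   equality of the squares leaves int_{s<0} F(t - s) d(mu - mu1)(s) = 0, t >= 0,
   and the above applies to the reflection of mu - mu1 on ]-oo, 0[.

   Uniqueness of Fourier transforms is obtained without an inversion formula:
   the functions with zero integral form a space stable under bounded pointwise
   limits and containing the trigonometric functions; iterating
   y |-> (3 y - y^3) / 2 turns sin (u (x - a)) into its sign, and u -> 0 gives
   the sign of x - a, hence the indicators of half-lines. *)

(** * Taylor remainders of the cosine; functions with uniform Taylor bounds *)

Section Taylor.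
Context {R : realType}.
Implicit Types (N n : nat) (x y t C : R) (F G : R -> R).

(** Taylor remainder of the cosine at [t]. The n-th derivative is written as the phase shift cos (t
    + n pi / 2), which avoids cases modulo 4. *)
Definition cos_rem N t y : R :=
  cos (t + y) - \sum_(0 <= n < N) cos (t + n%:R * (pi / 2)) * (y ^+ n / n`!%:R).

Lemma is_derive_expr_fact N y :
  is_derive y 1 (fun z : R => z ^+ N.+1 / N.+1`!%:R) (y ^+ N / N`!%:R).
Proof.
have -> : (fun z : R => z ^+ N.+1 / N.+1`!%:R) = (N.+1`!%:R)^-1 \*: (fun z : R => z ^+ N.+1).
  by apply/funext => z /=; rewrite mulrC.
have dX : is_derive y 1 (fun z : R => z ^+ N.+1) (N.+1%:R * y ^+ N).
  by split; [exact: exprn_derivable | rewrite exp_derive /GRing.scale /= mulr1].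
apply: (is_derive_eq (is_deriveZ _ dX)).
rewrite /GRing.scale /= factS natrM.
have h1 : N.+1%:R != 0 :> R by rewrite pnatr_eq0.
have h2 : N`!%:R != 0 :> R by rewrite pnatr_eq0 -lt0n fact_gt0.
by field; rewrite h2 addrC natr1 h1.
Qed.

(** Differentiation lowers each power of [y] by one, and the coefficients follow by shifting the
    phase by pi / 2, since cos' = cos (. + pi / 2). *)
Lemma is_derive_cos_rem N t y :
  is_derive y 1 (cos_rem N.+1 t) (cos_rem N (t + pi / 2) y).
Proof.
elim: N => [|N IH].
  have -> : cos_rem 1 t = (fun z => cos (t + z)) - cst (cos t).
    by apply/funext => z; rewrite /cos_rem big_nat1 mul0r addr0 expr0 fact0 divr1 mulr1.
  rewrite /cos_rem big_nil subr0 -addrA (addrC (pi / 2)) addrA cosDpihalf -[X in is_derive _ _ _ X]subr0.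
  apply: is_deriveB.
  have h : is_derive y 1 (cos \o (fun z => t + z)) (- sin (t + y) *: 1).
    apply: is_derive1_comp.
    by have := is_deriveD (is_derive_cst t y 1) (is_derive_id y 1); rewrite add0r.
  by move: h; rewrite /GRing.scale /= mulr1.
have -> : cos_rem N.+2 t = cos_rem N.+1 t -
   cos (t + N.+1%:R * (pi / 2)) \*: (fun z => z ^+ N.+1 / N.+1`!%:R).
  apply/funext => z; rewrite /cos_rem big_nat_recr //= opprD addrA.
  by [].
have -> : cos_rem N.+1 (t + pi / 2) y = cos_rem N (t + pi / 2) y -
   cos (t + N.+1%:R * (pi / 2)) *: (y ^+ N / N`!%:R).
  rewrite /cos_rem big_nat_recr //= opprD addrA; congr (_ - _ * _).
  by congr cos; rewrite -[N.+1%:R]natr1; ring.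
apply: is_deriveB; apply: is_deriveZ; exact: is_derive_expr_fact.
Qed.

(** Induction on [N]: y^(N+1) / (N+1)! and the remainder both vanish at 0, and the case [N] at phase
    [t + pi / 2] compares their derivatives. *)
Lemma cos_rem_ge0_le N t y : 0 <= y -> `|cos_rem N t y| <= y ^+ N / N`!%:R.
Proof.
elim: N t y => [|N IH] t y y0.
  by rewrite /cos_rem big_nil subr0 expr0 fact0 divr1 cos_max.
have rem0 : cos_rem N.+1 t 0 = 0.
  rewrite /cos_rem big_nat_recl // mul0r !addr0 expr0 fact0 divr1 mulr1.
  by rewrite big1 ?addr0 ?subrr // => i _; rewrite expr0n mul0r mulr0.
(* The sign [s] lets one monotonicity argument give both one-sided bounds. *)
have mono (s : R) : `|s| = 1 ->
    s * cos_rem N.+1 t y <= y ^+ N.+1 / N.+1`!%:R.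
  move=> s1.
  pose g : R -> R := (fun z => z ^+ N.+1 / N.+1`!%:R) - s \*: cos_rem N.+1 t.
  have dg (z : R) : is_derive z 1 g (z ^+ N / N`!%:R - s *: cos_rem N (t + pi / 2) z).
    apply: is_deriveB; first exact: is_derive_expr_fact.
    by apply: is_deriveZ; exact: is_derive_cos_rem.
  have : g 0 <= g y.
    apply: (@ger0_derive1_ndecry _ g 0); [| | |by []|by []].
    - move=> z _; exact: (@ex_derive _ _ _ _ _ _ _ (dg z)).
    - move=> z; rewrite in_itv/= andbT => z0.
      rewrite derive1E; have [_ ->] := dg z.
      rewrite subr_ge0 (le_trans (ler_norm _)) // normrM s1 mul1r IH //.
      exact: ltW.
    - apply: derivable_within_continuous => z _; exact: (@ex_derive _ _ _ _ _ _ _ (dg z)).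
  rewrite /g !fctE expr0n /= mul0r /GRing.scale /= rem0 mulr0 subr0.
  by rewrite subr_ge0.
rewrite ler_norml -lerN2 opprK; apply/andP; split.
  by rewrite -mulN1r mono // normrN normr1.
by rewrite -[leLHS]mul1r mono // normr1.
Qed.

Lemma cosDnpi n t : cos (t + n%:R * pi) = (-1) ^+ n * cos t.
Proof.
by rewrite mulr_natl (alternatingn (@cosDpi R)).
Qed.

(** The sign (-1)^n of the n-th power cancels the shift by n pi that arises when the phase is
    reflected. This carries the bound over to negative [y]. *)
Lemma cos_remN N t y : cos_rem N (- t) (- y) = cos_rem N t y.
Proof.
rewrite /cos_rem -opprD cosN; congr (_ - _); apply: eq_bigr => n _.
rewrite -cosN opprD opprK.
have -> : t + n%:R * (pi / 2) = t - n%:R * (pi / 2) + n%:R * pi.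
  by field.
by rewrite cosDnpi [(- y) ^+ n]exprNn -!mulrA mulrCA.
Qed.

Lemma cos_rem_le N t y : `|cos_rem N t y| <= `|y| ^+ N / N`!%:R.
Proof.
have [y0|y0] := leP 0 y; first by rewrite (ger0_norm y0) cos_rem_ge0_le.
by rewrite (ltr0_norm y0) -cos_remN cos_rem_ge0_le // oppr_ge0 ltW.
Qed.

(* [C] depends neither on [x] nor on [N], so the Taylor series has radius at least 1. *)
Definition taylor_bounded F := exists C, forall x, exists a : nat -> R,
  forall N y, `|F (x + y) - \sum_(0 <= n < N) a n * y ^+ n| <= C * `|y| ^+ N.

Lemma taylor_boundedD F G :
  taylor_bounded F -> taylor_bounded G -> taylor_bounded (F \+ G).
Proof.
move=> [C HF] [D HG]; exists (C + D) => x.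
have [a Ha] := HF x; have [b Hb] := HG x.
exists (fun n => a n + b n) => N y.
under eq_bigr do rewrite mulrDl.
rewrite big_split /= opprD addrACA mulrDl.
by rewrite (le_trans (ler_normD _ _)) // lerD.
Qed.

(** This is the estimate with N = 1 at [y], whose constant coefficient must be [F y]. *)
Lemma taylor_bounded_lipschitz F : taylor_bounded F ->
  exists C, forall x y, `|F x - F y| <= C * `|x - y|.
Proof.
move=> [C HF]; exists C => x y.
have [a Ha] := HF y.
have a0 : a 0 = F y.
  have := Ha 1 0; rewrite big_nat1 normr0 addr0 !expr1 expr0 mulr1 mulr0.
  by rewrite normr_le0 subr_eq0 => /eqP.
by have := Ha 1 (x - y); rewrite big_nat1 expr0 mulr1 a0 expr1 (addrC y) subrK.
Qed.

Lemma taylor_bounded_real_analytic F : taylor_bounded F -> real_analytic F.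
Proof.
move=> [C HF] x0; exists 1 => //.
have [a Ha] := HF x0; exists a => x x1.
apply/cvgrPdist_lt => e e0.
have cv : (fun n => C * `|x - x0| ^+ n) @ \oo --> C * 0.
  by apply: cvgMr; apply: cvg_expr; rewrite normr_id.
move: cv; rewrite mulr0 => /cvgr0Pnorm_lt /(_ e e0); apply: filterS => N.
have := Ha N (x - x0); rewrite (addrC x0) subrK => h; apply: le_lt_trans.
exact: le_trans h (ler_norm _).
Qed.

(** All Taylor coefficients at [x] vanish because [F] does to the right of [x]; within distance 1/2
    the remainder bound then reads C 2^-N for every N. *)
Lemma taylor_bounded_eq0_step F x : taylor_bounded F ->
  (forall y, x <= y -> F y = 0) -> forall y, x - 2^-1 <= y -> F y = 0.
Proof.
move=> [C HF] F0 y xy.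
have [xley|yltx] := leP x y; first exact: F0.
have [a Ha] := HF x.
have a0 m : a m = 0.
  have [k] := ubnP m; elim: k m => // k IH m; rewrite ltnS => mk.
  apply/normr0_eq0/eqP; rewrite eq_le normr_ge0 andbT.
  apply/ler_addgt0Pr => e e0; rewrite add0r.
  (* Once the lower coefficients are zero, division by z^m leaves |a m| <= C z, and this [z] makes
     the right-hand side at most [e]. *)
  pose z := e / (`|C| + 1).
  have C1 : 0 < `|C| + 1 by rewrite ltr_wpDl.
  have z0 : 0 < z by rewrite divr_gt0.
  have Fz : F (x + z) = 0 by apply: F0; rewrite lerDl ltW.
  have := Ha m.+1 z; rewrite big_nat_recr //= Fz.
  rewrite big_nat big1; last first.
    by move=> i /andP[_ im]; rewrite IH ?mul0r // (leq_trans im).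
  rewrite !add0r normrN normrM normrX (gtr0_norm z0) exprS mulrA ler_pM2r ?exprn_gt0 //.
  move/le_trans; apply; apply: (@le_trans _ _ ((`|C| + 1) * z)).
    by rewrite ler_pM2r // (le_trans (ler_norm C)) // lerDl.
  by rewrite /z mulrCA divff ?mulr1 // gt_eqF.
apply/normr0_eq0/eqP; rewrite eq_le normr_ge0 andbT.
have bd N : `|F y| <= C * (2^-1) ^+ N.
  have := Ha N (y - x); rewrite (addrC x) subrK big1 ?subr0; last first.
    by move=> i _; rewrite a0 mul0r.
  have C0 : 0 <= C.
    have := Ha 0%N 0; rewrite big_nil expr0 mulr1 => /le_trans h; exact: le_trans (h _ (lexx _)).
  move=> /le_trans; apply; apply: ler_wpM2l => //; apply: lerXn2r; rewrite ?nnegrE //.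
  by rewrite ler0_norm; lra.
have cv : (fun n => C * 2^-1 ^+ n) @ \oo --> C * (0 : R).
  by apply: cvgMr; apply: cvg_expr; rewrite ger0_norm //; lra.
rewrite mulr0 in cv.
by apply: (cvgr_to_ge cv); apply: nearW.
Qed.

(** The step 1/2 does not depend on the point, so more than 2 |y| steps to the left reach any
    [y]. *)
Lemma taylor_bounded_eq0 F : taylor_bounded F ->
  (forall y, 0 <= y -> F y = 0) -> forall y, F y = 0.
Proof.
move=> tF F0 y.
have H k : forall y, - (k%:R / 2) <= y -> F y = 0.
  elim: k => [|k IH] z; first by rewrite mul0r oppr0; exact: F0.
  move=> zk; apply: (taylor_bounded_eq0_step _ _ tF IH).
  by move: zk; rewrite -natr1; lra.
apply: (H (Num.truncn (2 * `|y|)).+1).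
have := @Num.Theory.truncnS_gt _ (2 * `|y|).
by have := ler_norm (- y); rewrite normrN; lra.
Qed.

End Taylor.

(** * A polynomial iteration converging to the sign function *)

Section sign_iteration.
Context {R : realType}.
Implicit Types (n : nat) (x y : R).

(** Odd polynomial p fixing -1, 0 and 1, with 1 - p(z) = (1 - z)^2 (2 + z) / 2. Being polynomial, it
    preserves any algebra of functions. *)
Definition sign_step y : R := y * (3 - y ^+ 2) / 2.

Lemma sign_stepN y : sign_step (- y) = - sign_step y.
Proof. by rewrite /sign_step sqrrN; ring. Qed.

Lemma iter_sign_stepN n y : iter n sign_step (- y) = - iter n sign_step y.
Proof. by elim: n => //= n ->; rewrite sign_stepN. Qed.

(** One step multiplies the gap 1 - z by 1 - (z + z^2) / 2, which is at most 1 - y / 2 because the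
    iterates stay above [y]. *)
Lemma iter_sign_step_gt0 n y : 0 < y <= 1 ->
  [/\ y <= iter n sign_step y, iter n sign_step y <= 1 &
      1 - iter n sign_step y <= (1 - y / 2) ^+ n].
Proof.
move=> /andP[y0 y1]; elim: n => [|n [+ +]] /=.
  by rewrite expr0; split => //; lra.
move: (iter n sign_step y) => z yz z1 h; rewrite /sign_step; split.
- by apply: (le_trans yz); nra.
- have : 0 <= (1 - z) ^+ 2 * (2 + z) by rewrite mulr_ge0 ?sqr_ge0 //; lra.
  by nra.
- have -> : 1 - z * (3 - z ^+ 2) / 2 = (1 - (z + z ^+ 2) / 2) * (1 - z) by field.
  rewrite [leRHS]exprS; apply: ler_pM => //; [nra|lra|nra].
Qed.

Lemma iter_sign_step_norm n y : `|y| <= 1 -> `|iter n sign_step y| <= 1.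
Proof.
rewrite !ler_norml => /andP[ym y1].
have [y0|y0|<-] := ltgtP 0 y.
- have [] := @iter_sign_step_gt0 n y; first by rewrite y0.
  by move=> h1 h2 _; apply/andP; split; lra.
- have [] := @iter_sign_step_gt0 n (- y); first by apply/andP; split; lra.
  by rewrite iter_sign_stepN => h1 h2 _; apply/andP; split; lra.
- have -> : iter n sign_step 0 = 0.
    by elim: n => //= n ->; rewrite /sign_step !mul0r.
  by rewrite lerN10 ler01.
Qed.

Lemma cvg_iter_sign_step_gt0 y : 0 < y <= 1 ->
  iter n sign_step y @[n --> \oo] --> (1 : R).
Proof.
move=> yI; apply/cvgrPdist_lt => e e0.
have cv : (1 - y / 2) ^+ n @[n --> \oo] --> (0 : R).
  by apply: cvg_expr; case/andP: yI => ? ?; rewrite ger0_norm; lra.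
move/cvgrPdist_lt : cv => /(_ e e0); apply: filterS => n.
have [h1 h2 h3] := iter_sign_step_gt0 n _ yI.
rewrite sub0r normrN [`|1 - _|]ger0_norm ?subr_ge0 // => /(le_lt_trans _); apply.
exact: le_trans h3 (ler_norm _).
Qed.

Lemma cvg_iter_sign_step y : `|y| <= 1 ->
  iter n sign_step y @[n --> \oo] --> Num.sg y.
Proof.
rewrite ler_norml => /andP[ym y1].
have [y0|y0|<-] := ltgtP 0 y.
- by rewrite gtr0_sg //; apply: cvg_iter_sign_step_gt0; rewrite y0.
- rewrite ltr0_sg //.
  have -> : (fun n => iter n sign_step y) = (fun n => - iter n sign_step (- y)).
    by apply/funext => n; rewrite iter_sign_stepN opprK.
  by apply: cvgN; apply: cvg_iter_sign_step_gt0; apply/andP; split; lra.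
- rewrite sgr0; apply: cvg_near_cst; apply: nearW.
  by elim => //= n ->; rewrite /sign_step !mul0r.
Qed.

End sign_iteration.

(** * From trigonometric functions to indicators of Borel sets *)

Section trigonometric_monotone_class.
Context {R : realType} (Z : set (R -> R)).
Hypothesis ZD : forall phi psi, Z phi -> Z psi -> Z (phi \+ psi).
Hypothesis ZM : forall (c : R) phi, Z phi -> Z (fun x => c * phi x).
Hypothesis Zlim : forall (phi_ : nat -> R -> R) phi (B : R),
  (forall n, Z (phi_ n)) -> (forall n x, `|phi_ n x| <= B) ->
  (forall x, phi_ n x @[n --> \oo] --> phi x) -> Z phi.
Hypothesis Zcos : forall u a : R, Z (fun x => cos (u * x + a)).

(** All cosine factors are built in, so that multiplication by a cosine preserves the class. *)
Let M : set (R -> R) := [set phi | (exists B : R, forall x, `|phi x| <= B) /\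
  forall u a : R, Z (fun x => phi x * cos (u * x + a))].

(* The multipliers of [M]: unlike [Z], this class is visibly stable under products. *)
Let N : set (R -> R) := [set psi | forall phi, M phi -> M (fun x => phi x * psi x)].

Let N_cst (c : R) : N (fun=> c).
Proof.
move=> phi [[B hB] hZ]; split => [|u a].
  by exists (B * `|c|) => x; rewrite normrM ler_wpM2r.
have -> : (fun x => phi x * c * cos (u * x + a)) =
    (fun x => c * (phi x * cos (u * x + a))) by apply/funext => x; ring.
exact: ZM.
Qed.

Let N_add psi1 psi2 : N psi1 -> N psi2 -> N (fun x => psi1 x + psi2 x).
Proof.
move=> N1 N2 phi Mphi.
have [[B1 h1] Z1] := N1 _ Mphi; have [[B2 h2] Z2] := N2 _ Mphi.
split => [|u a].
  by exists (B1 + B2) => x; rewrite mulrDr (le_trans (ler_normD _ _)) // lerD.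
have -> : (fun x => phi x * (psi1 x + psi2 x) * cos (u * x + a)) =
    (fun x => phi x * psi1 x * cos (u * x + a)) \+
    (fun x => phi x * psi2 x * cos (u * x + a)) by apply/funext => x /=; ring.
exact: ZD.
Qed.

Let N_mul psi1 psi2 : N psi1 -> N psi2 -> N (fun x => psi1 x * psi2 x).
Proof.
move=> N1 N2 phi Mphi.
have -> : (fun x => phi x * (psi1 x * psi2 x)) =
  (fun x => phi x * psi1 x * psi2 x) by apply/funext => x; rewrite mulrA.
exact/N2/N1.
Qed.

(** The product formula turns two cosine factors into half the sum of cosines of frequencies w + u
    and w - u. *)
Let N_cos (w z : R) : N (fun x => cos (w * x + z)).
Proof.
move=> phi [[B hB] hZ]; split => [|u a].
  exists B => x; rewrite normrM (le_trans _ (hB x)) //.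
  by rewrite -[leRHS]mulr1 ler_wpM2l // cos_max.
have -> : (fun x => phi x * cos (w * x + z) * cos (u * x + a)) =
   (fun x => 2^-1 * (phi x * cos ((w + u) * x + (z + a)))) \+
   (fun x => 2^-1 * (phi x * cos ((w - u) * x + (z - a)))).
  apply/funext => x /=.
  have -> : (w + u) * x + (z + a) = (w * x + z) + (u * x + a) by ring.
  have -> : (w - u) * x + (z - a) = (w * x + z) - (u * x + a) by ring.
  move: (w * x + z) (u * x + a) => b c.
  by rewrite cosD cosB; field.
by apply: ZD; apply: ZM.
Qed.

Let N_lim (psi_ : nat -> R -> R) psi (B : R) :
  (forall n, N (psi_ n)) -> (forall n x, `|psi_ n x| <= B) ->
  (forall x, psi_ n x @[n --> \oo] --> psi x) -> N psi.
Proof.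
move=> Npsi psiB psil phi Mphi; have [[C hC] _] := Mphi.
have BC n x : `|phi x * psi_ n x| <= C * B by rewrite normrM ler_pM.
have cv x : phi x * psi_ n x @[n --> \oo] --> phi x * psi x.
  by apply: cvgMr; exact: psil.
split => [|u a].
  exists (C * B) => x; apply: (cvgr_to_le (cvg_norm (cv x))).
  by apply: nearW => n; exact: BC.
apply: (@Zlim (fun n x => phi x * psi_ n x * cos (u * x + a)) _ (C * B)).
- by move=> n; have [_] := Npsi n _ Mphi; exact.
- move=> n x; rewrite normrM (le_trans _ (BC n x)) //.
  by rewrite -[leRHS]mulr1 ler_wpM2l // cos_max.
- by move=> x; apply: cvgMl; exact: cv.
Qed.

(** [N] is an algebra containing the constants, and [sign_step] is a polynomial. *)
Let N_iter_sign_step psi n : N psi -> N (fun x => iter n sign_step (psi x)).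
Proof.
move=> Npsi; elim: n => //= n IH.
have -> : (fun x => sign_step (iter n sign_step (psi x))) =
   (fun x => iter n sign_step (psi x) *
     (3 / 2 + (- 2^-1) * (iter n sign_step (psi x) * iter n sign_step (psi x)))).
  by apply/funext => x; rewrite /sign_step; field.
by apply: N_mul => //; apply: N_add; [|apply: N_mul => //; apply: N_mul].
Qed.

Let N_sg_sin (u a : R) : N (fun x => Num.sg (sin (u * (x - a)))).
Proof.
have sinE x : sin (u * (x - a)) = cos (u * x + (- (u * a) - pi / 2)).
  by rewrite -cosBpihalf; congr cos; ring.
apply: (@N_lim (fun n x => iter n sign_step (sin (u * (x - a)))) _ 1).
- move=> n; apply: (N_iter_sign_step (fun x => sin (u * (x - a)))).
  have -> : (fun x => sin (u * (x - a))) =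
      (fun x => cos (u * x + (- (u * a) - pi / 2))) by apply/funext => x.
  exact: N_cos.
- by move=> n x; apply: iter_sign_step_norm; rewrite sin_max.
- by move=> x; apply: cvg_iter_sign_step; rewrite sin_max.
Qed.

(** For large n the number (x - a) / (n + 1) lies between -pi and pi, where the sine has the sign of
    its argument; the sequence is eventually constant at each point. *)
Let N_sg (a : R) : N (fun x => Num.sg (x - a)).
Proof.
apply: (@N_lim (fun n x => Num.sg (sin (n.+1%:R^-1 * (x - a)))) _ 1) => //.
- by move=> n x; rewrite normr_sg; case: (_ != 0).
move=> x; apply: cvg_near_cst; near=> n.
have sgE y : 0 < y -> n.+1%:R^-1 * y < pi -> Num.sg (sin (n.+1%:R^-1 * y)) = 1 :> R.
  move=> y0 ypi; rewrite gtr0_sg // sin_gt0_pi // ypi andbT.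
  by rewrite mulr_gt0 // invr_gt0.
have bd : n.+1%:R^-1 * `|x - a| < pi.
  rewrite mulrC ltr_pdivrMr //.
  have : `|x - a| < n%:R by near: n; exact: nbhs_infty_gtr.
  have := @pi_ge2 R; rewrite -natr1.
  have : 0 <= n%:R :> R by [].
  nra.
have [y0|y0|->] := ltgtP (x - a) 0.
- rewrite [RHS]ltr0_sg // -[x - a]opprK mulrN sinN sgrN sgE ?oppr_gt0 //.
  by rewrite -(ltr0_norm y0).
- by rewrite [RHS]gtr0_sg // sgE // -(gtr0_norm y0).
- by rewrite mulr0 sin0.
Unshelve. all: by end_near. Qed.

(** With s the sign of x - a, the indicator is s (s + 1) / 2. *)
Let N_indic_ray (a : R) : N \1_(`]a, +oo[%classic : set R).
Proof.
have -> : \1_(`]a, +oo[%classic : set R) =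
    (fun x => 2^-1 * (Num.sg (x - a) * (Num.sg (x - a) + 1))) :> (R -> R).
  apply/funext => x; rewrite indicE mem_setE in_itv/= andbT.
  rewrite -subr_gt0; have [y0|y0|->] := ltgtP (x - a) 0.
  - by rewrite ltr0_sg // addNr !mulr0.
  - by rewrite gtr0_sg //= mul1r -[1 + 1]/(2%:R) mulVf.
  - by rewrite sgr0 mul0r mulr0.
by apply: N_mul => //; apply: N_mul => //; apply: N_add.
Qed.

(** Complements are 1 - 1_A; finite unions grow by adding (1 - 1_U) 1_A to 1_U; countable unions are
    bounded limits, eventually constant at each point. *)
Let N_indic_sigma_algebra : sigma_algebra setT [set A | N \1_A].
Proof.
split=> /=.
- have -> : \1_(set0 : set R) = (fun=> 0) :> (R -> R) by rewrite indic0.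
  exact: N_cst.
- move=> A NA.
  have -> : \1_(setT `\` A) = (fun x => 1 + (-1) * \1_A x) :> (R -> R).
    apply/funext => x; rewrite !indicE in_setD in_setT /=.
    by case: (x \in A); rewrite /= ?mulr1 ?mulr0 ?subrr ?addr0 ?mulN1r.
  by apply: N_add => //; apply: N_mul.
- move=> A NA.
  have Nn n : N \1_(\bigcup_(i < n) A i).
    elim: n => [|n IH].
      rewrite bigcup_mkord big_ord0 indic0; exact: N_cst.
    have -> : \1_(\bigcup_(i < n.+1) A i) = (fun x => \1_(\bigcup_(i < n) A i) x +
        (1 + (-1) * \1_(\bigcup_(i < n) A i) x) * \1_(A n) x) :> (R -> R).
      apply/funext => x; rewrite !bigcup_mkord big_ord_recr /= !indicE in_setU.
      by case: (_ \in _); case: (_ \in _); rewrite /= ?mulr1 ?mulr0 ?subrr ?addr0 ?mul0r ?addr0 ?add0r ?mulr1 ?addr0.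
    by apply: N_add => //; apply: N_mul => //; apply: N_add => //; apply: N_mul.
  apply: (@N_lim (fun n => \1_(\bigcup_(i < n) A i)) _ 1) => //.
    by move=> n x; rewrite indicE; case: (_ \in _); rewrite ?normr1 ?normr0.
  move=> x; apply: cvg_near_cst.
  have [/[dup] [[m _ Am] xA]|xA] := pselect ((\bigcup_k A k) x).
    near=> n; rewrite !indicE [in RHS]mem_set // mem_set //.
    by exists m => //=; near: n; exact: nbhs_infty_gt.
  apply: nearW => n; rewrite !indicE [in RHS]memNset // memNset //.
  by move=> [m _ Am]; apply: xA; exists m.
Unshelve. all: by end_near. Qed.

(** The open right half-lines generate the Borel sets, so every Borel indicator is a multiplier. *)
Lemma trig_class_indic (A : set R) : measurable A -> Z \1_A.
Proof.
move=> mA.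
have NA : N \1_A.
  have : (@RGenOInfty.G R).-sigma.-measurable A by rewrite -RGenOInfty.measurableE.
  move: A {mA}; apply: smallest_sub => //.
  by move=> _ /= [a ->].
(* The constant 1 belongs to [M] by [Zcos]. Multiplying it by the indicator and taking both
   frequency and phase 0 leaves the indicator itself in [Z]. *)
have [_ /(_ 0 0)] : M (fun x => 1 * \1_A x).
  apply: NA; split; first by exists 1 => x; rewrite normr1.
  move=> u a; have -> : (fun x => 1 * cos (u * x + a)) = (fun x => cos (u * x + a)).
    by apply/funext => x; rewrite mul1r.
  exact: Zcos.
suff -> : (fun x => 1 * \1_A x * cos (0 * x + 0)) = \1_A :> (R -> R) by [].
by apply/funext => x; rewrite mul1r mul0r addr0 cos0 mulr1.
Qed.

End trigonometric_monotone_class.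

(** * Bounded measurable functions *)

Definition bounded_measurable {R : realType} (phi : R -> R) :=
  measurable_fun setT phi /\ exists B : R, forall x, `|phi x| <= B.

Section bounded_measurable.
Context {R : realType}.
Implicit Types phi psi : R -> R.

Lemma bounded_measurableD phi psi :
  bounded_measurable phi -> bounded_measurable psi -> bounded_measurable (phi \+ psi).
Proof.
move=> [mphi [B hB]] [mpsi [C hC]]; split; first exact: measurable_funD.
by exists (B + C) => x; rewrite (le_trans (ler_normD _ _)) // lerD.
Qed.

Lemma bounded_measurableM phi psi :
  bounded_measurable phi -> bounded_measurable psi -> bounded_measurable (phi \* psi).
Proof.
move=> [mphi [B hB]] [mpsi [C hC]]; split; first exact: measurable_funM.
by exists (B * C) => x; rewrite normrM ler_pM.
Qed.

Lemma bounded_measurableZ (c : R) phi :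
  bounded_measurable phi -> bounded_measurable (fun x => c * phi x).
Proof.
move=> [mphi [B hB]]; split; first exact: measurable_funM.
by exists (`|c| * B) => x; rewrite normrM ler_wpM2l.
Qed.

Lemma bounded_measurable_shift phi (t : R) :
  bounded_measurable phi -> bounded_measurable (fun x => phi (t + x)).
Proof.
move=> [mphi [B hB]]; split; last by exists B.
by apply: measurableT_comp => //; exact: measurable_funD.
Qed.

End bounded_measurable.

(** * Integration against the image of a signed measure *)

Section weighted_integral.
Context d (T : measurableType d) {R : realType} (nu : {measure set T -> \bar R}).
Variables (rho : T -> R) (w : T -> R).
Hypothesis mrho : measurable_fun setT rho.
Hypothesis iw : nu.-integrable setT (EFin \o w).
Implicit Types phi psi : R -> R.

(** Integral of [phi] against the image under [rho] of the signed measure w nu. With [rho] the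
    identity this covers densities on the line; with [rho] the opposite, reflected measures. *)
Definition wint phi : R := \int[nu]_s (phi (rho s) * w s).

Let mw : measurable_fun setT w.
Proof. by apply/measurable_EFinP; exact: measurable_int iw. Qed.

Lemma measurable_wint phi : measurable_fun setT phi ->
  measurable_fun setT (fun s => phi (rho s) * w s).
Proof. by move=> mphi; apply: measurable_funM => //; exact: measurableT_comp. Qed.

Lemma integrable_wint phi : bounded_measurable phi ->
  nu.-integrable setT (EFin \o (fun s => phi (rho s) * w s)).
Proof.
move=> [mphi [B hB]].
apply: (@le_integrable _ _ _ nu setT measurableT _ (EFin \o (fun s => B * w s))).
- exact/measurable_EFinP/measurable_wint.
- move=> s _ /=; rewrite lee_fin !normrM ler_wpM2r //.
  exact: le_trans (hB _) (ler_norm _).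
- exact: (@integrableZl _ _ _ nu setT measurableT B _ iw).
Qed.

Lemma wintD phi psi : bounded_measurable phi -> bounded_measurable psi ->
  wint (phi \+ psi) = wint phi + wint psi.
Proof.
move=> bphi bpsi; rewrite /wint -RintegralD //; try exact: integrable_wint.
by apply: eq_Rintegral => s _ /=; rewrite mulrDl.
Qed.

Lemma wintZ (c : R) phi : bounded_measurable phi ->
  wint (fun x => c * phi x) = c * wint phi.
Proof.
move=> bphi; rewrite /wint -RintegralZl //; last exact: integrable_wint.
by apply: eq_Rintegral => s _ /=; rewrite mulrA.
Qed.

Lemma wint_bounded_cvg (phi_ : nat -> R -> R) phi (B : R) :
  (forall n, measurable_fun setT (phi_ n)) -> (forall n x, `|phi_ n x| <= B) ->
  measurable_fun setT phi -> (forall x, phi_ n x @[n --> \oo] --> phi x) ->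
  wint (phi_ n) @[n --> \oo] --> wint phi.
Proof.
move=> mphi_ phiB mphi cv; rewrite /wint /Rintegral.
have bphi : bounded_measurable phi.
  split=> //; exists B => x; apply: (cvgr_to_le (cvg_norm (cv x))).
  by apply: nearW => n; exact: phiB.
apply: fine_cvg; rewrite fineK; last first.
  by apply: integrable_fin_num => //; exact: integrable_wint.
have [| | | | |_ _ cvg_int] := @dominated_convergence _ _ _ nu setT measurableT
  (fun n s => (phi_ n (rho s) * w s)%:E) (fun s => (phi (rho s) * w s)%:E)
  (fun s => (`|B * w s|)%:E).
- by move=> n; exact/measurable_EFinP/measurable_wint.
- exact/measurable_EFinP/measurable_wint.
- apply: aeW => s _; apply: cvg_EFin; first exact: nearW.
  by apply: cvgMl; exact: cv.
- exact: (integrable_abse (integrableZl measurableT B iw)).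
- apply: aeW => s n _; rewrite abse_EFin lee_fin !normrM ler_wpM2r //.
  exact: le_trans (phiB _ _) (ler_norm _).
- exact: cvg_int.
Qed.

Lemma wint_le phi (B : R) : (forall x, `|phi x| <= B) -> bounded_measurable phi ->
  `|wint phi| <= B * \int[nu]_s `|w s|.
Proof.
move=> hB bphi; rewrite /wint.
have iaw : nu.-integrable setT (EFin \o (fun s => `|w s|)).
  exact: (integrable_abse iw).
rewrite (le_trans (le_normr_Rintegral _ _)) //; first exact: integrable_wint.
rewrite -RintegralZl //; apply: le_Rintegral => //.
- exact: (integrable_abse (integrable_wint _ bphi)).
- exact: (@integrableZl _ _ _ nu setT measurableT B _ iaw).
- by move=> s _; rewrite normrM ler_wpM2r.
Qed.

End weighted_integral.
Arguments wint {d T R} nu rho w phi.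

Lemma measurable_cos {R : realType} : measurable_fun setT (@cos R).
Proof. by apply: continuous_measurable_fun; exact: continuous_cos. Qed.

Lemma measurable_cos_affine {R : realType} (u a : R) :
  measurable_fun setT (fun x : R => cos (u * x + a)).
Proof.
apply: (measurableT_comp measurable_cos).
by apply: measurable_funD => //; apply: measurable_funM.
Qed.

Lemma bounded_measurable_cos {R : realType} (u a : R) :
  bounded_measurable (fun x : R => cos (u * x + a)).
Proof.
split; first exact: measurable_cos_affine.
by exists 1 => x; rewrite cos_max.
Qed.

(** * Uniqueness of Fourier transforms *)

Section fourier_uniqueness.
Context d (T : measurableType d) {R : realType}.
Variables (nu1 nu2 : {measure set T -> \bar R}) (rho w1 w2 : T -> R).
Hypothesis mrho : measurable_fun setT rho.
Hypothesis iw1 : nu1.-integrable setT (EFin \o w1).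
Hypothesis iw2 : nu2.-integrable setT (EFin \o w2).

(** The bounded measurable functions with equal integrals on both sides form a space containing the
    cosines and, by dominated convergence, closed under bounded pointwise limits. *)
Lemma wint_fourier_unique :
  (forall u a : R, wint nu1 rho w1 (fun x => cos (u * x + a)) =
                   wint nu2 rho w2 (fun x => cos (u * x + a))) ->
  forall A : set R, measurable A ->
    wint nu1 rho w1 \1_A = wint nu2 rho w2 \1_A.
Proof.
move=> cosE A mA.
suff [] : bounded_measurable (\1_A : R -> R) /\
  wint nu1 rho w1 \1_A = wint nu2 rho w2 \1_A by [].
pose Z : set (R -> R) := [set phi | bounded_measurable phi /\
  wint nu1 rho w1 phi = wint nu2 rho w2 phi].
apply: (@trig_class_indic R Z) => //.
- move=> phi psi [bphi ephi] [bpsi epsi]; split; first exact: bounded_measurableD.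
  by rewrite !wintD // ephi epsi.
- move=> c phi [bphi ephi]; split; last by rewrite !wintZ // ephi.
  exact: bounded_measurableZ.
- move=> phi_ phi B Zphi phiB cv.
  have mphi : measurable_fun setT phi.
    apply: (measurable_fun_cvg (h := phi_)) => //.
    by move=> n; have [[]] := Zphi n.
  split.
    split=> //; exists B => x; apply: (cvgr_to_le (cvg_norm (cv x))).
    by apply: nearW => n; exact: phiB.
  have h1 := @wint_bounded_cvg _ _ _ nu1 rho w1 mrho iw1 phi_ phi B.
  have h2 := @wint_bounded_cvg _ _ _ nu2 rho w2 mrho iw2 phi_ phi B.
  have mphi_ n : measurable_fun setT (phi_ n) by have [[]] := Zphi n.
  have e12 : (fun n => wint nu1 rho w1 (phi_ n)) = (fun n => wint nu2 rho w2 (phi_ n)).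
    by apply/funext => n; have [] := Zphi n.
  have := h1 mphi_ phiB mphi cv; rewrite e12 => {}h1.
  exact: (cvg_unique _ h1 (h2 mphi_ phiB mphi cv)).
- by move=> u a; split; first exact: bounded_measurable_cos.
Qed.

End fourier_uniqueness.

Lemma wint_indic_ae_eq0 {R : realType} (h : R -> R) :
  lebesgue_measure.-integrable setT (EFin \o h) ->
  (forall A : set R, measurable A -> wint lebesgue_measure idfun h \1_A = 0) ->
  {ae lebesgue_measure, forall x, h x = 0}.
Proof.
move=> ih h0.
have hA (A : set R) : measurable A -> (\int[lebesgue_measure]_(x in A) (h x)%:E = 0)%E.
  move=> mA; have := h0 A mA; rewrite /wint /Rintegral.
  have -> : (fun x => (\1_A (idfun x) * h x)%:E) = (EFin \o h) \_ A.
    apply/funext => x; rewrite patchE indicE /=.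
    by case: (x \in A); rewrite ?mul1r ?mul0r.
  rewrite -integral_mkcond => H.
  rewrite -[LHS]fineK ?H //.
  apply: integrable_fin_num => //.
  exact: (@integrableS _ _ _ lebesgue_measure setT).
have := @integral_ae_eq _ _ _ lebesgue_measure setT measurableT (cst 0%E) (EFin \o h) ih.
move=> /(_ (@measurable_cst _ _ _ _ _ _)) H.
have : ae_eq lebesgue_measure setT (EFin \o h) (cst 0%E).
  by apply: H => E _ mE; rewrite hA // integral0.
by apply: filterS => x /(_ I) [].
Qed.

Lemma wint_weight0 {R : realType} (phi : R -> R) :
  wint (@lebesgue_measure R) idfun (fun=> 0) phi = 0.
Proof.
rewrite /wint; under eq_Rintegral do rewrite mulr0.
by rewrite /Rintegral integral0.
Qed.

Lemma fourier_eq0 {R : realType} (h : R -> R) :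
  lebesgue_measure.-integrable setT (EFin \o h) ->
  (forall u a : R, wint lebesgue_measure idfun h (fun x => cos (u * x + a)) = 0) ->
  {ae lebesgue_measure, forall x, h x = 0}.
Proof.
move=> ih h0; apply: wint_indic_ae_eq0 => // A mA; rewrite -(wint_weight0 \1_A).
apply: (@wint_fourier_unique _ _ _ lebesgue_measure lebesgue_measure idfun h (fun=> 0)
    (@measurable_id _ _ _) ih) => //; first exact: integrable0.
by move=> u a; rewrite h0 wint_weight0.
Qed.

(** * Factorial moment bounds and Taylor bounds of Fourier integrals *)

Section moments.
Context {R : realType}.
Notation leb := (@lebesgue_measure R).
Implicit Types (h k : R -> R) (C : R).

(** The growth C n! is what the factor 1 / n! in the cosine remainder absorbs. *)
Definition moments_le h C := measurable_fun setT h /\ forall n : nat,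
  (\int[leb]_u (`|u| ^+ n * `|h u|)%:E <= (C * n`!%:R)%:E)%E.

Lemma moments_le_integrable h C n : moments_le h C ->
  leb.-integrable setT (EFin \o (fun u => `|u| ^+ n * `|h u|)).
Proof.
move=> [mh hC]; apply/integrableP; split.
  apply/measurable_EFinP; apply: measurable_funM.
    by apply: measurable_funX; exact: normr_measurable.
  exact: measurableT_comp.
apply: le_lt_trans (ltry (C * n`!%:R)); apply: le_trans (hC n).
by under eq_integral do rewrite /= ger0_norm //.
Qed.

Lemma moments_le_Rintegral h C n : moments_le h C ->
  \int[leb]_u (`|u| ^+ n * `|h u|) <= C * n`!%:R.
Proof.
move=> hC; rewrite -lee_fin /Rintegral fineK; first by have [_] := hC; exact.
by apply: integrable_fin_num => //; exact: moments_le_integrable hC.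
Qed.

Lemma moments_le_integrable0 h C : moments_le h C ->
  leb.-integrable setT (EFin \o h).
Proof.
move=> hC; apply: le_integrable (moments_le_integrable _ _ 0 hC) => //.
  by apply/measurable_EFinP; have [] := hC.
by move=> u _ /=; rewrite expr0 mul1r normr_id.
Qed.

Lemma moments_le_dominated h k (B C : R) : 0 <= B -> measurable_fun setT k ->
  (forall u, `|k u| <= B * `|h u|) -> moments_le h C -> moments_le k (B * C).
Proof.
move=> B0 mk kh hC; split=> // n.
have ik : leb.-integrable setT (EFin \o (fun u => B * (`|u| ^+ n * `|h u|))).
  exact: (integrableZl measurableT B (moments_le_integrable _ _ n hC)).
apply: (@le_trans _ _ (\int[leb]_u (B * (`|u| ^+ n * `|h u|))%:E)%E).
  apply: ge0_le_integral => //.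
  - apply/measurable_EFinP; apply: measurable_funM; last exact: measurableT_comp.
    by apply: measurable_funX; exact: normr_measurable.
  - exact: measurable_int ik.
  - by move=> u _; rewrite lee_fin mulrCA ler_wpM2l // exprn_ge0.
under eq_integral do rewrite EFinM.
rewrite integralZl //; last exact: moments_le_integrable hC.
by rewrite -mulrA EFinM lee_wpmul2l ?lee_fin //; have [_] := hC; exact.
Qed.

Lemma cos_remS N (t y : R) : cos_rem N.+1 t y =
  cos_rem N t y - cos (t + N%:R * (pi / 2)) * (y ^+ N / N`!%:R).
Proof. by rewrite /cos_rem big_nat_recr //= opprD addrA. Qed.

Lemma measurable_cos_rem N (x y a : R) :
  measurable_fun setT (fun u : R => cos_rem N (x * u + a) (y * u)).
Proof.
elim: N => [|N IH].
  have -> : (fun u => cos_rem 0 (x * u + a) (y * u)) = (fun u => cos ((x + y) * u + a)).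
    by apply/funext => u; rewrite /cos_rem big_nil subr0 mulrDl addrAC.
  exact: measurable_cos_affine.
have -> : (fun u => cos_rem N.+1 (x * u + a) (y * u)) =
  (fun u => cos_rem N (x * u + a) (y * u) -
    cos (x * u + (a + N%:R * (pi / 2))) * (((y * u) ^+ N) * N`!%:R^-1)).
  by apply/funext => u; rewrite cos_remS addrA.
apply: measurable_funB => //; apply: measurable_funM.
  exact: measurable_cos_affine.
apply: measurable_funM => //; apply: measurable_funX.
exact: measurable_funM.
Qed.

Lemma integrable_cos_rem h C N (x y a : R) : moments_le h C ->
  leb.-integrable setT (EFin \o (fun u => cos_rem N (x * u + a) (y * u) * h u)).
Proof.
move=> hC; have [mh _] := hC.
apply: (@le_integrable _ _ _ leb setT measurableT _
   (EFin \o (fun u => (`|y| ^+ N / N`!%:R) * (`|u| ^+ N * `|h u|)))).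
- apply/measurable_EFinP; apply: measurable_funM => //; exact: measurable_cos_rem.
- move=> u _ /=; rewrite lee_fin normrM [leRHS]ger0_norm; last first.
    by rewrite !mulr_ge0 // ?invr_ge0 ?exprn_ge0.
  rewrite mulrA ler_wpM2r // (le_trans (cos_rem_le _ _ _)) // normrM exprMn.
  by rewrite mulrAC.
- exact: (integrableZl measurableT _ (moments_le_integrable _ _ N hC)).
Qed.

(** The pointwise bound |y u|^N / N! integrates to |y|^N / N! times the N-th absolute moment, and
    the factorials cancel. *)
Lemma Rintegral_cos_rem_le h C N (x y a : R) : moments_le h C ->
  `|\int[leb]_u (cos_rem N (x * u + a) (y * u) * h u)| <= C * `|y| ^+ N.
Proof.
move=> hC; have [mh _] := hC.
have ir := integrable_cos_rem h C N x y a hC.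
rewrite (le_trans (le_normr_Rintegral _ _)) //.
apply: (@le_trans _ _ (\int[leb]_u ((`|y| ^+ N / N`!%:R) * (`|u| ^+ N * `|h u|)))).
  apply: le_Rintegral => //.
  - exact: (integrable_abse ir).
  - exact: (integrableZl measurableT _ (moments_le_integrable _ _ N hC)).
  - move=> u _; rewrite normrM mulrA ler_wpM2r // (le_trans (cos_rem_le _ _ _)) //.
    by rewrite normrM exprMn mulrAC.
rewrite RintegralZl //; last exact: moments_le_integrable hC.
have f0 : N`!%:R != 0 :> R by rewrite pnatr_eq0 -lt0n fact_gt0.
have -> : C * `|y| ^+ N = `|y| ^+ N / N`!%:R * (C * N`!%:R) by field.
apply: ler_wpM2l; last exact: moments_le_Rintegral.
by rewrite divr_ge0 // exprn_ge0.
Qed.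

(** The coefficients are the integrals of the Taylor terms of the cosine, so by linearity the
    remainder of the transform is the integral of the cosine remainder. *)
Lemma taylor_bounded_fourier h C (a : R) : moments_le h C ->
  taylor_bounded (fun t => wint leb idfun h (fun u => cos (t * u + a))).
Proof.
move=> hC; exists C => x; have [mh _] := hC.
pose c n := \int[leb]_u (cos (x * u + a + n%:R * (pi / 2)) * (u ^+ n / n`!%:R) * h u).
exists c => N y.
suff -> : wint leb idfun h (fun u => cos ((x + y) * u + a)) -
    \sum_(0 <= n < N) c n * y ^+ n =
    \int[leb]_u (cos_rem N (x * u + a) (y * u) * h u).
  exact: Rintegral_cos_rem_le.
elim: N => [|N IH].
  rewrite big_nil subr0; apply: eq_Rintegral => u _ /=.
  by rewrite /cos_rem big_nil subr0 mulrDl addrAC.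
rewrite big_nat_recr //= opprD addrA IH /c.
have ic : leb.-integrable setT (EFin \o (fun u =>
    cos (x * u + a + N%:R * (pi / 2)) * (u ^+ N / N`!%:R) * h u)).
  apply: (@le_integrable _ _ _ leb setT measurableT _
     (EFin \o (fun u => N`!%:R^-1 * (`|u| ^+ N * `|h u|)))).
  - apply/measurable_EFinP; apply: measurable_funM => //; apply: measurable_funM.
      under eq_fun do rewrite -addrA.
      exact: measurable_cos_affine.
    by apply: measurable_funM => //; exact: measurable_funX.
  - move=> u _ /=; rewrite lee_fin [leRHS]ger0_norm; last first.
      by rewrite !mulr_ge0 // ?invr_ge0 ?exprn_ge0.
    rewrite normrM [leRHS]mulrA ler_wpM2r // normrM -[leRHS]mul1r ler_pM ?cos_max //.
    by rewrite normrM normrX normfV normr_nat mulrC.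
  - exact: (integrableZl measurableT _ (moments_le_integrable _ _ N hC)).
rewrite -RintegralZr // -RintegralB //.
- by apply: eq_Rintegral => u _; rewrite cos_remS exprMn; ring.
- exact: integrable_cos_rem hC.
- exact: (integrableZr measurableT (y ^+ N) ic).
Qed.

End moments.

(** * Cosine and sine transforms of a weighted measure *)

Section characteristic_function.
Context d (T : measurableType d) {R : realType} (nu : {measure set T -> \bar R}).
Variables (rho : T -> R) (w : T -> R).
Hypothesis mrho : measurable_fun setT rho.
Hypothesis iw : nu.-integrable setT (EFin \o w).
Implicit Types a b t u : R.

(* [cwint u 0] and [cwint u (- (pi / 2))] are the cosine and sine transforms. *)
Definition cwint u a : R := wint nu rho w (fun x => cos (u * x + a)).

(** Addition formula for the cosine, with [cos (a + pi / 2)] standing for - sin a. *)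
Lemma cwintE u a : cwint u a = cos a * cwint u 0 + cos (a + pi / 2) * cwint u (- (pi / 2)).
Proof.
rewrite /cwint -!wintZ //; try exact: bounded_measurable_cos.
rewrite -wintD //;
  try by apply: bounded_measurableZ; exact: bounded_measurable_cos.
congr (wint _ _ _ _); apply/funext => x /=.
by rewrite addr0 cosBpihalf cosDpihalf cosD; ring.
Qed.

(** Dominated convergence along sequences, the cosines being bounded by 1. *)
Lemma cwint_continuous a : continuous (cwint ^~ a).
Proof.
move=> t; apply/(@cvg_nbhsP _ R^o) => u ut.
apply: (@wint_bounded_cvg _ _ _ nu rho w mrho iw (fun n x => cos (u n * x + a)) _ 1).
- by move=> n; exact: measurable_cos_affine.
- by move=> n x; exact: cos_max.
- exact: measurable_cos_affine.
- move=> x; apply: continuous_cvg; first exact: continuous_cos.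
  by apply: cvgD; [apply: cvgMl|exact: cvg_cst].
Qed.

Lemma bounded_measurable_cwint a : bounded_measurable (cwint ^~ a).
Proof.
split; first by apply: continuous_measurable_fun; exact: cwint_continuous.
exists (1 * \int[nu]_s `|w s|) => u; apply: wint_le => //.
  by move=> x; exact: cos_max.
exact: bounded_measurable_cos.
Qed.

End characteristic_function.
Arguments cwint {d T R} nu rho w u a.

(** * Fubini exchange of a measure and a Fourier integral *)

Section fubini_fourier.
Context d (T : measurableType d) {R : realType}.
Variables (nu : {sigma_finite_measure set T -> \bar R}) (rho w : T -> R) (h : R -> R).
Notation leb := (@lebesgue_measure R).
Hypothesis mrho : measurable_fun setT rho.
Hypothesis iw : nu.-integrable setT (EFin \o w).
Hypothesis ih : leb.-integrable setT (EFin \o h).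
Implicit Types a t u : R.

(** The phase varies with [u]; the addition formula splits it off from the two fixed-phase
    transforms. *)
Lemma bounded_measurable_cwint_shift t a :
  bounded_measurable (fun u => cwint nu rho w u (t * u + a)).
Proof.
have -> : (fun u => cwint nu rho w u (t * u + a)) =
  ((fun u => cos (t * u + a)) \* (cwint nu rho w ^~ 0)) \+
  ((fun u => cos (t * u + (a + pi / 2))) \* (cwint nu rho w ^~ (- (pi / 2)))).
  by apply/funext => u /=; rewrite cwintE // addrA.
by apply: bounded_measurableD; apply: bounded_measurableM;
  [exact: bounded_measurable_cos|exact: bounded_measurable_cwint
  |exact: bounded_measurable_cos|exact: bounded_measurable_cwint].
Qed.

(** Fubini, together with (t + rho s) u + a = u rho s + (t u + a): the former frequency term t u
    becomes a phase. *)
Lemma wint_cwint t a :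
  wint nu rho w (fun x => cwint leb idfun h (t + x) a) =
  wint leb idfun h (fun u => cwint nu rho w u (t * u + a)).
Proof.
pose g (su : T * R) : \bar R := (cos ((t + rho su.1) * su.2 + a) * h su.2 * w su.1)%:E.
have mh : measurable_fun setT h by apply/measurable_EFinP; exact: measurable_int ih.
have mw : measurable_fun setT w by apply/measurable_EFinP; exact: measurable_int iw.
have mg : measurable_fun setT g.
  apply/measurable_EFinP; apply: measurable_funM; last exact: measurableT_comp.
  apply: measurable_funM; last exact: measurableT_comp.
  apply: (measurableT_comp measurable_cos); apply: measurable_funD => //.
  apply: measurable_funM => //; apply: measurable_funD => //.
  exact: measurableT_comp.
have igx s : leb.-integrable setT (EFin \o (fun u => cos ((t + rho s) * u + a) * h u)).
  apply: (@integrable_wint _ _ _ leb idfun h (@measurable_id _ _ _) ih (fun u => cos ((t + rho s) * u + a))).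
  exact: bounded_measurable_cos.
have igy u : nu.-integrable setT (EFin \o (fun s => cos (u * rho s + (t * u + a)) * w s)).
  apply: (@integrable_wint _ _ _ nu rho w mrho iw (fun x => cos (u * x + (t * u + a)))).
  exact: bounded_measurable_cos.
(* The integrand is dominated by |h u| |w s|, a product of integrable functions. *)
have ig : (nu \x leb)%E.-integrable setT g.
  apply/integrable12ltyP => //.
  have lefin : (\int[leb]_u `|(h u)%:E| < +oo)%E by have /integrableP[] := ih.
  have h0 : (0 <= \int[leb]_u `|(h u)%:E|)%E by exact: integral_ge0.
  apply: (@le_lt_trans _ _ (\int[nu]_s (\int[leb]_u `|(h u)%:E| * `|(w s)%:E|))%E).
    apply: ge0_le_integral => //.
    - by move=> s _; exact: integral_ge0.
    - have := @measurable_fun_fubini_tonelli_F _ _ _ _ _ leb (abse \o g); apply => [|su].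
        exact: measurableT_comp.
      exact: abse_ge0.
    - apply: measurable_funeM; apply: measurableT_comp => //.
      exact/measurable_EFinP.
    - move=> s _; rewrite muleC -ge0_integralZl //; last first.
        by apply: measurableT_comp => //; exact/measurable_EFinP.
      apply: ge0_le_integral => //.
      + apply: measurableT_comp => //.
        exact: (measurableT_comp mg (measurable_pair1 s)).
      + apply: measurable_funeM; apply: measurableT_comp => //.
        exact/measurable_EFinP.
      + move=> u _; rewrite /g /= -EFinM lee_fin !normrM mulrC ler_wpM2l //.
        by rewrite -[leRHS]mul1r ler_wpM2r // cos_max.
  rewrite ge0_integralZl //; last first.
    by apply: measurableT_comp => //; exact/measurable_EFinP.
  rewrite lte_mul_pinfty //; first by rewrite ge0_fin_numE.
  by have /integrableP[] := iw.
rewrite /wint /Rintegral.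
have -> : (\int[nu]_s (cwint leb idfun h (t + rho s) a * w s)%:E =
           \int[nu]_s \int[leb]_u g (s, u))%E.
  apply: eq_integral => s _; rewrite EFinM /cwint /wint /Rintegral fineK; last first.
    by apply: integrable_fin_num => //; exact: igx.
  rewrite muleC -integralZl //; last exact: igx.
  apply: eq_integral => u _.
  by rewrite /g /= -EFinM mulrC.
rewrite Fubini //; congr fine; apply: eq_integral => u _.
rewrite EFinM /cwint /wint /Rintegral fineK; last first.
  by apply: integrable_fin_num => //; exact: igy.
rewrite muleC -integralZl //; last exact: igy.
 apply: eq_integral => s _.
rewrite /g /= -EFinM; congr (_ %:E).
have -> : (t + rho s) * u + a = u * rho s + (t * u + a) by ring.
ring.
Qed.

End fubini_fourier.

(** * Parity of the cosine and sine transforms *)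

Section parity.
Context d (T : measurableType d) {R : realType} (nu : {measure set T -> \bar R}).
Variables (rho : T -> R) (w : T -> R).
Hypothesis mrho : measurable_fun setT rho.
Hypothesis iw : nu.-integrable setT (EFin \o w).

Lemma cwintN0 (t : R) : cwint nu rho w (- t) 0 = cwint nu rho w t 0.
Proof.
by congr (wint _ _ _ _); apply/funext => x; rewrite !addr0 mulNr cosN.
Qed.

Lemma cwintNpihalf (t : R) :
  cwint nu rho w (- t) (- (pi / 2)) = - cwint nu rho w t (- (pi / 2)).
Proof.
rewrite -[RHS]mulN1r /cwint -wintZ //; last exact: bounded_measurable_cos.
congr (wint _ _ _ _); apply/funext => x.
by rewrite !cosBpihalf mulNr sinN mulN1r.
Qed.

Lemma cwint_pihalf (t : R) : cwint nu rho w t (pi / 2) = - cwint nu rho w t (- (pi / 2)).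
Proof. by rewrite cwintE // cosDpihalf cos_pihalf sin_pihalf mul0r add0r mulN1r. Qed.

Lemma cwint_eq0 (t : R) : cwint nu rho w t 0 = 0 -> cwint nu rho w t (- (pi / 2)) = 0 ->
  forall a, cwint nu rho w t a = 0.
Proof. by move=> h0 h1 a; rewrite cwintE // h0 h1 !mulr0 addr0. Qed.

End parity.

(** * Injectivity when k vanishes on no interval *)

Section injectivity.
Context d (T : measurableType d) {R : realType}.
Variables (nu1 nu2 : {sigma_finite_measure set T -> \bar R}) (rho w1 w2 : T -> R).
Variables (kr ki kappa : R -> R) (C : R).
Notation leb := (@lebesgue_measure R).
Hypothesis mrho : measurable_fun setT rho.
Hypothesis iw1 : nu1.-integrable setT (EFin \o w1).
Hypothesis iw2 : nu2.-integrable setT (EFin \o w2).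
Hypotheses (mkr : measurable_fun setT kr) (mki : measurable_fun setT ki).
Hypothesis kappaC : moments_le kappa C.
Hypothesis kr_le : forall u, `|kr u| <= `|kappa u|.
Hypothesis ki_le : forall u, `|ki u| <= `|kappa u|.

Let q1 := cwint nu1 rho w1.
Let q2 := cwint nu2 rho w2.
Let qc u := q1 u 0 - q2 u 0.
Let qs u := q1 u (- (pi / 2)) - q2 u (- (pi / 2)).

(* Real and imaginary parts of k times the transform of w1 nu1 - w2 nu2. *)
Let hr u := qc u * kr u - qs u * ki u.
Let hi u := qs u * kr u + qc u * ki u.

Let q12E u b : q1 u b - q2 u b = cos b * qc u + cos (b + pi / 2) * qs u.
Proof. rewrite /q1 (@cwintE _ _ _ nu1 rho w1 mrho iw1 u b).
by rewrite /q2 (@cwintE _ _ _ nu2 rho w2 mrho iw2 u b) /qc /qs /q1 /q2; ring. Qed.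

Let bm_qc : bounded_measurable qc.
Proof.
have -> : qc = (q1 ^~ 0) \+ (fun u => -1 * q2 u 0).
  by apply/funext => u /=; rewrite mulN1r.
apply: bounded_measurableD; first exact: bounded_measurable_cwint.
by apply: bounded_measurableZ; exact: bounded_measurable_cwint.
Qed.

Let bm_qs : bounded_measurable qs.
Proof.
have -> : qs = (q1 ^~ (- (pi / 2))) \+ (fun u => -1 * q2 u (- (pi / 2))).
  by apply/funext => u /=; rewrite mulN1r.
apply: bounded_measurableD; first exact: bounded_measurable_cwint.
by apply: bounded_measurableZ; exact: bounded_measurable_cwint.
Qed.

Let moments_kr : moments_le kr (1 * C).
Proof. by apply: (moments_le_dominated kappa) => // u; rewrite mul1r. Qed.

Let moments_ki : moments_le ki (1 * C).
Proof. by apply: (moments_le_dominated kappa) => // u; rewrite mul1r. Qed.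

Let ikr := moments_le_integrable0 _ _ moments_kr.
Let iki := moments_le_integrable0 _ _ moments_ki.

(** The transforms [qc] and [qs] are bounded, so their products with k inherit the moment bounds of
    [kappa]. *)
Let moments_h : exists D, moments_le hr D /\ moments_le hi D.
Proof.
have [mqc [B1 hB1]] := bm_qc; have [mqs [B2 hB2]] := bm_qs.
have B1_ge0 : 0 <= B1 by exact: le_trans (hB1 0).
have B2_ge0 : 0 <= B2 by exact: le_trans (hB2 0).
exists ((B1 + B2) * C); split; apply: (moments_le_dominated kappa) => //.
- by rewrite addr_ge0.
- by apply: measurable_funB; exact: measurable_funM.
- move=> u; rewrite mulrDl (le_trans (ler_normB _ _)) // !normrM.
  by rewrite lerD // ler_pM.
- by rewrite addr_ge0.
- by apply: measurable_funD; exact: measurable_funM.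
- move=> u; rewrite addrC mulrDl (le_trans (ler_normD _ _)) // !normrM.
  by rewrite lerD // ler_pM.
Qed.

Let ihr : leb.-integrable setT (EFin \o hr).
Proof. by have [D [h _]] := moments_h; exact: moments_le_integrable0 h. Qed.

Let ihi : leb.-integrable setT (EFin \o hi).
Proof. by have [D [_ h]] := moments_h; exact: moments_le_integrable0 h. Qed.

(* [a = 0] and [a = - (pi / 2)] give the real and imaginary parts of the
   transform of kr + i ki. *)
Definition phase_fourier (a t : R) : R :=
  cwint leb idfun kr t a + cwint leb idfun ki t (a + pi / 2).

Let mid : measurable_fun setT (@idfun R) := @measurable_id _ _ _.

(** After the Fubini exchange, the addition formula regroups the integrand as the product of k with
    the difference of the two transforms. *)
Let wint_phase_fourier a t :
  wint nu1 rho w1 (fun x => phase_fourier a (t + x)) -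
  wint nu2 rho w2 (fun x => phase_fourier a (t + x)) =
  cwint leb idfun hr t a + cwint leb idfun hi t (a + pi / 2).
Proof.
have bk (k : R -> R) (b : R) : leb.-integrable setT (EFin \o k) ->
    bounded_measurable (fun x => cwint leb idfun k (t + x) b).
  move=> ik; apply: (bounded_measurable_shift (cwint leb idfun k ^~ b)).
  exact: bounded_measurable_cwint.
have H (nu : {sigma_finite_measure set T -> \bar R}) (w : T -> R) :
    nu.-integrable setT (EFin \o w) ->
    wint nu rho w (fun x => phase_fourier a (t + x)) =
    wint leb idfun kr (fun u => cwint nu rho w u (t * u + a)) +
    wint leb idfun ki (fun u => cwint nu rho w u (t * u + (a + pi / 2))).
  move=> iw; rewrite -!wint_cwint // -wintD //; exact: bk.
rewrite (H nu1 w1 iw1) (H nu2 w2 iw2) {H} /wint /cwint -/(q1 _ _).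
have ib1 (k : R -> R) (b : R) : leb.-integrable setT (EFin \o k) ->
   leb.-integrable setT (EFin \o (fun u => q1 u (t * u + b) * k u)).
  move=> ik; apply: (@integrable_wint _ _ _ leb idfun k mid ik (fun u => q1 u (t * u + b))).
  exact: bounded_measurable_cwint_shift.
have ib2 (k : R -> R) (b : R) : leb.-integrable setT (EFin \o k) ->
   leb.-integrable setT (EFin \o (fun u => q2 u (t * u + b) * k u)).
  move=> ik; apply: (@integrable_wint _ _ _ leb idfun k mid ik (fun u => q2 u (t * u + b))).
  exact: bounded_measurable_cwint_shift.
have ic (k : R -> R) (b : R) : leb.-integrable setT (EFin \o k) ->
   leb.-integrable setT (EFin \o (fun u => cos (t * u + b) * k u)).
  move=> ik; apply: (@integrable_wint _ _ _ leb idfun k mid ik (fun u => cos (t * u + b))).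
  exact: bounded_measurable_cos.
rewrite -RintegralD //; [|exact: ib1|exact: ib1].
rewrite -[X in _ - X]RintegralD //; [|exact: ib2|exact: ib2].
rewrite -[RHS]RintegralD //; [|exact: ic|exact: ic].
rewrite -RintegralB //; last 2 first.
- exact: (integrableD measurableT (ib1 _ a ikr) (ib1 _ (a + pi / 2) iki)).
- exact: (integrableD measurableT (ib2 _ a ikr) (ib2 _ (a + pi / 2) iki)).
apply: eq_Rintegral => u _ /=; rewrite -/(q1 _ _) -/(q2 _ _) -/(q1 _ _) -/(q2 _ _).
transitivity ((q1 u (t * u + a) - q2 u (t * u + a)) * kr u +
  (q1 u (t * u + (a + pi / 2)) - q2 u (t * u + (a + pi / 2))) * ki u).
  rewrite /q1 /q2 /cwint /wint; ring.
rewrite !q12E /hr /hi !addrA; move: (t * u + a) => b.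
by rewrite 2!cosDpihalf sinDpihalf; ring.
Qed.

Hypothesis wint_eq : forall a t, a = 0 \/ a = - (pi / 2) -> 0 <= t ->
  wint nu1 rho w1 (fun x => phase_fourier a (t + x)) =
  wint nu2 rho w2 (fun x => phase_fourier a (t + x)).

(** The hypothesis gives the vanishing for nonnegative times, and the Taylor bounds extend it to all
    times. *)
Let fourier_h_eq0 a t : a = 0 \/ a = - (pi / 2) ->
  cwint leb idfun hr t a + cwint leb idfun hi t (a + pi / 2) = 0.
Proof.
move=> a_phase; have [D [hrD hiD]] := moments_h.
have tb := taylor_boundedD _ _ (taylor_bounded_fourier _ _ a hrD)
   (taylor_bounded_fourier _ _ (a + pi / 2) hiD).
apply: (taylor_bounded_eq0 _ tb) => s s0 /=.
by have := wint_phase_fourier a s; rewrite wint_eq // subrr => ->.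
Qed.

Let h_ae_eq0 : {ae leb, forall u, hr u = 0 /\ hi u = 0}.
Proof.
(* Two phases at the times t and -t give four linear equations; by parity these separate the cosine
   and sine transforms of [hr] and [hi]. *)
have XY t : [/\ cwint leb idfun hr t 0 = 0, cwint leb idfun hr t (- (pi / 2)) = 0,
   cwint leb idfun hi t 0 = 0 & cwint leb idfun hi t (- (pi / 2)) = 0].
  have := fourier_h_eq0 0 t (or_introl erefl).
  have := fourier_h_eq0 0 (- t) (or_introl erefl).
  have := fourier_h_eq0 (- (pi / 2)) t (or_intror erefl).
  have := fourier_h_eq0 (- (pi / 2)) (- t) (or_intror erefl).
  rewrite add0r addNr !cwint_pihalf // !cwintN0 !cwintNpihalf //.
  by move=> *; split; lra.
have hr0 : {ae leb, forall u, hr u = 0}.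
  by apply: fourier_eq0 => // u a; apply: cwint_eq0 => //; have [] := XY u.
have hi0 : {ae leb, forall u, hi u = 0}.
  by apply: fourier_eq0 => // u a; apply: cwint_eq0 => //; have [] := XY u.
by apply: (@filterS2 _ _ (ae_filter_ringOfSetsType leb)) hr0 hi0 => u.
Qed.

Hypothesis k_nonvanishing : forall a b : R, a < b ->
  ~ {ae leb, forall u, u \in `]a, b[ -> kr u = 0 /\ ki u = 0}.

(** If the difference q of the transforms were nonzero at [u0], by continuity it would be nonzero on
    an interval around it, and q k = 0 a.e. would force k = 0 a.e. there. *)
Let q_eq0 u0 : qc u0 = 0 /\ qs u0 = 0.
Proof.
have q2_eq0 : qc u0 ^+ 2 + qs u0 ^+ 2 = 0.
  apply/eqP; rewrite eq_le addr_ge0 ?sqr_ge0 // andbT leNgt; apply/negP => q_gt0.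
  have cq : {for u0, continuous (fun u => qc u ^+ 2 + qs u ^+ 2)}.
    have cc : {for u0, continuous qc}.
      by apply: cvgB; exact: cwint_continuous.
    have cs : {for u0, continuous qs}.
      by apply: cvgB; exact: cwint_continuous.
    under [X in {for _, continuous X}]eq_fun do rewrite !expr2.
    by apply: cvgD; apply: cvgM.
  have nq : \forall u \near u0, 0 < qc u ^+ 2 + qs u ^+ 2 by exact: (cvgr_gt _ cq).
  have /nbhs_ballP[e /= e0 he] := nq.
  apply: (k_nonvanishing (u0 - e) (u0 + e)); first by rewrite ltrD2l gtrN.
  apply: (@filterS _ _ (ae_filter_ringOfSetsType leb)) h_ae_eq0 => u [hru hiu]; rewrite in_itv /= => /andP[u1 u2].
  have qu : 0 < qc u ^+ 2 + qs u ^+ 2.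
    by apply: he; rewrite /ball /= ltr_norml; apply/andP; split; lra.
  have q0 : qc u ^+ 2 + qs u ^+ 2 != 0 by rewrite gt_eqF.
  split; apply: (mulfI q0); rewrite mulr0.
    (* Multiplication of [hr] + i [hi] = q k by the conjugate of q gives |q|^2 k; this is the real
       part, and the imaginary part follows. *)
    have -> : (qc u ^+ 2 + qs u ^+ 2) * kr u = qc u * hr u + qs u * hi u.
      by rewrite /hr /hi; ring.
    by rewrite hru hiu !mulr0 addr0.
  have -> : (qc u ^+ 2 + qs u ^+ 2) * ki u = qc u * hi u - qs u * hr u.
    by rewrite /hr /hi; ring.
  by rewrite hru hiu !mulr0 subr0.
move/eqP: q2_eq0; rewrite paddr_eq0 ?sqr_ge0 // !sqrf_eq0.
by case/andP => /eqP -> /eqP ->.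
Qed.

Lemma wint_indic_eq (A : set R) : measurable A ->
  wint nu1 rho w1 \1_A = wint nu2 rho w2 \1_A.
Proof.
apply: wint_fourier_unique => // u a; apply/eqP; rewrite -subr_eq0; apply/eqP.
have := q12E u a; have [-> ->] := q_eq0 u.
by rewrite !mulr0 addr0.
Qed.

End injectivity.

(** * From a finite upper limit to a uniform bound *)

Section limn_esup_bounded.
Context {R : realType}.

(** A finite upper limit bounds a tail by its supremum; the finitely many remaining terms are
    bounded by their sum. *)
Lemma limn_esup_lty_bounded (u : nat -> \bar R) :
  (forall n, (0 <= u n)%E) -> (forall n, (u n < +oo)%E) ->
  (limn_esup u < +oo)%E -> exists C : R, forall n, (u n <= C%:E)%E.
Proof.
move=> u0 uy /ereal_inf_lt [_ [V [N _ NV] <-]] Vy.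
set s := ereal_sup (u @` V) in Vy.
have us n : (N <= n)%N -> (u n <= s)%E.
  by move=> Nn; apply: ereal_sup_ubound; exists n => //; exact: NV.
have s_fin : s \is a fin_num.
  by rewrite ge0_fin_numE //; exact: le_trans (us N (leqnn _)).
have sum_ge0 (k : nat) : 0 <= \sum_(0 <= i < k) fine (u i).
  by apply: sumr_ge0 => i _; rewrite fine_ge0.
exists (\sum_(0 <= i < N) fine (u i) + fine s) => n.
have [Nn|nN] := leqP N n.
  by rewrite EFinD fineK // (le_trans (us n Nn)) // leeDr // lee_fin.
rewrite -[u n]fineK ?ge0_fin_numE // lee_fin.
rewrite (bigD1_seq n) //= ?mem_index_iota ?iota_uniq //.
rewrite -addrA lerDl addr_ge0 //; first by apply: sumr_ge0 => i _; rewrite fine_ge0.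
by rewrite fine_ge0 // (le_trans (u0 N)) // us.
Qed.

End limn_esup_bounded.

(** * Convolution squares on the nonnegative half-line *)

Section convolution_square.
Context {R : realType}.
Implicit Types (m : probability R R) (A : set R).
Notation nneg := (`[(0 : R)%R, +oo[%classic : set R).
Notation neg := (`]-oo, (0 : R)%R[%classic : set R).

(** The translate A - y, in the very form used by [mconv] so that the two are convertible. *)
Definition shift_set A (y : R) : set R := [set x | (x + y)%R \in A].

Definition sum_set A : set (R * R) := [set xy | A (xy.1 + xy.2)].

Lemma measurable_sum_set A : measurable A -> measurable (sum_set A).
Proof.
move=> mA; rewrite -[sum_set A]setTI.
have mD : measurable_fun setT (fun xy : R * R => xy.1 + xy.2).
  exact: measurable_funD.
exact: mD.
Qed.

Lemma ysection_sum_set A y : ysection (sum_set A) y = shift_set A y.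
Proof.
apply/seteqP; split=> x; rewrite /ysection /shift_set /=.
  by rewrite !inE.
by rewrite !inE.
Qed.

Lemma measurable_shift_set A y : measurable A -> measurable (shift_set A y).
Proof.
by move=> mA; rewrite -ysection_sum_set; apply: measurable_ysection; exact: measurable_sum_set.
Qed.

Lemma mconvpow1E m A : measurable A -> mconvpow m 1 A = m A.
Proof.
move=> mA; rewrite /= /mconv.
under eq_integral => y _.
  rewrite diracE; have -> : (0 \in shift_set A y) = (y \in A).
    by apply/idP/idP; rewrite !inE /shift_set /= add0r inE.
  over.
by rewrite (integral_indic _ measurableT) // setIT.
Qed.

Lemma mconvpow2E m A : measurable A ->
  (mconvpow m 2 A = \int[m]_y m (shift_set A y))%E.
Proof.
move=> mA; rewrite [LHS]/= /mconv; apply: eq_integral => y _.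
exact: (mconvpow1E m (shift_set A y) (measurable_shift_set A y mA)).
Qed.

Lemma integral_section_swap m (U : set (R * R)) : measurable U ->
  (\int[m]_x m (xsection U x) = \int[m]_y m (ysection U y))%E.
Proof.
move=> mU; have := @indic_fubini_tonelli _ _ _ _ R m m U mU.
by rewrite indic_fubini_tonelli_FE // indic_fubini_tonelli_GE.
Qed.

Lemma measurable_measure_shiftI m A B : measurable A -> measurable B ->
  measurable_fun setT (fun y => m (shift_set A y `&` B)).
Proof.
move=> mA mB; have mU : measurable (sum_set A `&` (B `*` setT)).
  by apply: measurableI; [exact: measurable_sum_set|exact: measurableX].
have := @measurable_fun_ysection _ _ _ _ R m _ mU.
apply: eq_measurable_fun => y _ /=; congr (m _).
apply/seteqP; split=> x; rewrite /ysection /shift_set /= !inE /=.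
  by move=> [? []].
by move=> [].
Qed.

Lemma measurable_measure_shift m A : measurable A ->
  measurable_fun setT (fun y => m (shift_set A y)).
Proof.
move=> mA; have := measurable_measure_shiftI m A setT mA measurableT.
by apply: eq_measurable_fun => y _; rewrite setIT.
Qed.

Lemma negU_nneg : neg `|` nneg = setT.
Proof.
apply/seteqP; split=> // x _ /=; rewrite !in_itv /= andbT.
by case: (ltP x 0) => h; [left|right].
Qed.

Lemma disj_neg_nneg : [disjoint neg & nneg].
Proof.
apply/disj_setPS => x [] /=; rewrite !in_itv /= andbT => x0.
by rewrite leNgt x0.
Qed.

(* A sum landing in [0, oo[ has at most one negative term, and by symmetry both
   mixed terms contribute the same amount. *)
Lemma mconvpow2_split m A : measurable A -> A `<=` nneg ->
  (mconvpow m 2 A = \int[m]_(y in neg) m (shift_set A y) +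
    (\int[m]_(y in nneg) m (shift_set A y `&` nneg) +
     \int[m]_(y in neg) m (shift_set A y)))%E.
Proof.
move=> mA A0; rewrite mconvpow2E //.
have mneg : measurable neg by exact: measurable_itv.
have mnneg : measurable nneg by exact: measurable_itv.
have ms := measurable_measure_shift m A mA.
rewrite -negU_nneg ge0_integral_setU //; last 2 first.
- by rewrite negU_nneg.
- exact: disj_neg_nneg.
congr (_ + _)%E.
(* For nonnegative y, the first summand x is split according to its sign. *)
transitivity (\int[m]_(y in nneg) (m (shift_set A y `&` nneg) + m (shift_set A y `&` neg)))%E.
  apply: eq_integral => y _; rewrite -measureU //.
  - by rewrite -setIUr setUC negU_nneg setIT.
  - by apply: measurableI => //; exact: measurable_shift_set.
  - by apply: measurableI => //; exact: measurable_shift_set.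
  - rewrite setIACA setIid [nneg `&` _]setIC.
    by have /disj_set2P -> := disj_neg_nneg; rewrite setI0.
rewrite ge0_integralD //; last 2 first.
- by apply: measurable_funS (measurable_measure_shiftI m A _ mA mnneg).
- by apply: measurable_funS (measurable_measure_shiftI m A _ mA mneg).
congr (_ + _)%E.
(* Pairs with x < 0 <= y and sum in [A]: integrating the y-sections gives one mixed term,
   integrating the x-sections the other. *)
pose U : set (R * R) := sum_set A `&` (neg `*` nneg).
have mU : measurable U.
  by apply: measurableI; [exact: measurable_sum_set|exact: measurableX].
transitivity (\int[m]_y m (ysection U y))%E.
  rewrite integral_mkcond; apply: eq_integral => y _; rewrite patchE.
  case: ifPn => ynn.
    congr (m _); apply/seteqP; split=> x; rewrite /ysection /shift_set /U /= !inE /=.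
      by move=> [? ?]; split=> //; split=> //; move: ynn; rewrite inE.
    by move=> [? []].
  rewrite (_ : ysection U y = set0) ?measure0 //.
  apply/seteqP; split=> // x; rewrite /ysection /U /= inE /= => -[_ [_ ynn']].
  by move/negP : ynn; apply; rewrite inE.
rewrite -integral_section_swap // [RHS]integral_mkcond.
apply: eq_integral => x _; rewrite patchE; case: ifPn => xn.
  congr (m _); apply/seteqP; split=> y; rewrite /xsection /shift_set /U /= !inE /=.
    by move=> [Axy _]; rewrite addrC.
  (* Since x < 0 and x + y >= 0, the condition y >= 0 is automatic, so the x-section is the full
     translate. *)
  rewrite addrC => Axy; split=> //; move: xn; rewrite inE => xn; split=> //.
  move: xn (A0 _ Axy); rewrite /= !in_itv /= !andbT => x0 xy0.
  by move: x0 xy0; lra.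
rewrite (_ : xsection U x = set0) ?measure0 //.
apply/seteqP; split=> // y; rewrite /xsection /U /= inE /= => -[_ [xn' _]].
by move/negP : xn; apply; rewrite inE.
Qed.

Variables m1 m2 : probability R R.
Hypothesis m12 : forall A, measurable A -> A `<=` nneg -> m1 A = m2 A.
Hypothesis m12_conv : forall A, measurable A -> A `<=` nneg ->
  mconvpow m1 2 A = mconvpow m2 2 A.

(** In the split of the squares the term with two nonnegative summands is common to both sides. For
    y < 0 the translate A - y lies in [0, oo[, so [m2] of it may be replaced by [m1]. The mixed term
    occurs twice on each side, all terms are finite, and halving gives the claim. *)
Lemma integral_neg_shift_eq A : measurable A -> A `<=` nneg ->
  (\int[m1]_(y in neg) m1 (shift_set A y) = \int[m2]_(y in neg) m1 (shift_set A y))%E.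
Proof.
move=> mA A0.
have mneg : measurable neg by exact: measurable_itv.
have mnneg : measurable nneg by exact: measurable_itv.
have := m12_conv A mA A0; rewrite !mconvpow2_split //.
have -> : (\int[m2]_(y in nneg) m2 (shift_set A y `&` nneg) =
           \int[m1]_(y in nneg) m1 (shift_set A y `&` nneg))%E.
  rewrite (eq_measure_integral m1); last by move=> B mB B0; apply/esym/m12.
  apply: eq_integral => y _; rewrite m12 //.
  by apply: measurableI => //; exact: measurable_shift_set.
have -> : (\int[m2]_(y in neg) m2 (shift_set A y) = \int[m2]_(y in neg) m1 (shift_set A y))%E.
  apply: eq_integral => y; rewrite inE /= in_itv /= => y0.
  rewrite m12 //; first exact: measurable_shift_set.
  move=> x; rewrite /shift_set /= inE => /A0 /=; rewrite !in_itv /= !andbT; lra.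
have fin (m : probability R R) (D : set R) (F : R -> \bar R) : measurable D ->
    measurable_fun setT F -> (forall y, 0 <= F y <= 1)%E ->
    (\int[m]_(y in D) F y)%E \is a fin_num.
  move=> mD mF F01; rewrite ge0_fin_numE; last first.
    by apply: integral_ge0 => y _; have /andP[] := F01 y.
  apply: (@le_lt_trans _ _ (\int[m]_(y in D) cst 1 y)%E).
    apply: ge0_le_integral => //.
    - by move=> y _; have /andP[] := F01 y.
    - exact: measurable_funS mF.
    - by move=> y _; have /andP[] := F01 y.
  rewrite integral_cst // mul1e; apply: le_lt_trans (probability_le1 _ _) _ => //.
  exact: ltry.
have finJ (m : probability R R) : (\int[m]_(y in neg) m1 (shift_set A y))%E \is a fin_num.
  apply: fin => //; first exact: measurable_measure_shift.
  by move=> y; rewrite measure_ge0 probability_le1 //; exact: measurable_shift_set.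
have finI : (\int[m1]_(y in nneg) m1 (shift_set A y `&` nneg))%E \is a fin_num.
  apply: fin => //; first exact: measurable_measure_shiftI.
  move=> y; rewrite measure_ge0 probability_le1 //; apply: measurableI => //.
  exact: measurable_shift_set.
move: (finJ m1) (finJ m2) finI.
move: (\int[m1]_(y in neg) _)%E (\int[m2]_(y in neg) _)%E (\int[m1]_(y in nneg) _)%E.
move=> [a| |] // [b| |] // [c| |] // _ _ _ /= [] e; congr (_ %:E); lra.
Qed.

End convolution_square.

Lemma integrableB_EFin d (T : measurableType d) (R : realType)
    (mu : {measure set T -> \bar R}) (D : set T) (f g : T -> R) :
  measurable D -> mu.-integrable D (EFin \o f) -> mu.-integrable D (EFin \o g) ->
  mu.-integrable D (EFin \o (fun x => f x - g x)).
Proof.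
move=> mD fi gi; have -> : EFin \o (fun x => f x - g x) = ((EFin \o f) \- (EFin \o g))%E.
  by apply/funext => x /=; rewrite EFinB.
exact: integrableB.
Qed.

(** * Averages of Lipschitz functions over short intervals *)

Section lipschitz_average.
Context {R : realType}.
Notation leb := (@lebesgue_measure R).

(** An error of at most C e is integrated over length e. The order e^2 allows values of [F] to be
    recovered from masses of short intervals. *)
Lemma Rintegral_lipschitz_le (F : R -> R) (C c e : R) : 0 < e ->
  measurable_fun setT F -> (forall x y, `|F x - F y| <= C * `|x - y|) ->
  `|\int[leb]_(x in `[c, (c + e)%R]) F x - e * F c| <= C * e * e.
Proof.
move=> e0 mF FC.
have C0 : 0 <= C.
  by have := le_trans (normr_ge0 _) (FC 1 0); rewrite subr0 normr1 mulr1.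
have mI : measurable (`[c, (c + e)%R]%classic : set R) by exact: measurable_itv.
have lebI : leb `[c, (c + e)%R] = e%:E.
  by rewrite lebesgue_measure_itv /= lte_fin ltrDl e0 -EFinD addrAC subrr add0r.
have lebIy : (leb `[c, (c + e)%R] < +oo)%E by rewrite lebI ltry.
have Fce x : x \in `[c, (c + e)%R] -> `|F x - F c| <= C * e.
  rewrite in_itv /= => /andP[cx xc]; apply: le_trans (FC _ _) _.
  by rewrite ler_wpM2l // ger0_norm; lra.
have icst (r : R) : leb.-integrable `[c, (c + e)%R] (EFin \o cst r).
  by apply: measurable_bounded_integrable => //; exists `|r|; split => // M rM x _ /=; exact: ltW.
have iF : leb.-integrable `[c, (c + e)%R] (EFin \o F).
  apply: measurable_bounded_integrable => //; first exact: measurable_funS mF.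
  exists (`|F c| + C * e); split => [|M hM x /= xI]; first exact: num_real.
  apply: (le_trans _ (ltW hM)); rewrite -[F x](subrK (F c)) addrC.
  by rewrite (le_trans (ler_normD _ _)) // lerD2l Fce.
have iFc : leb.-integrable `[c, (c + e)%R] (EFin \o (fun x => F x - F c)).
  exact: integrableB_EFin iF (icst (F c)).
have -> : e * F c = \int[leb]_(x in `[c, (c + e)%R]) cst (F c) x.
  rewrite Rintegral_cst // mulrC; congr (_ * _).
  exact: (congr1 fine (esym lebI)).
rewrite -RintegralB //.
rewrite (le_trans (le_normr_Rintegral _ _)) //.
apply: (@le_trans _ _ (\int[leb]_(x in `[c, (c + e)%R]) cst (C * e) x)).
  by apply: le_Rintegral => //; exact: integrable_norm.
rewrite Rintegral_cst //; apply: ler_wpM2l; first by rewrite mulr_ge0 // ltW.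
have le_e : fine (leb `[c, (c + e)%R]) <= e by rewrite lebI.
exact: le_e.
Qed.

End lipschitz_average.

(** * The integral identity for the negative parts of the two measures *)

Section negative_part.
Context {R : realType}.
Notation leb := (@lebesgue_measure R).
Notation nneg := (`[(0 : R)%R, +oo[%classic : set R).
Notation neg := (`]-oo, (0 : R)%R[%classic : set R).
Implicit Types (t e y : R) (A : set R).
Variables (mu mu1 : probability R R) (f F : R -> R) (C : R).
Hypothesis mu_density : forall A : set R, measurable A ->
  mu A = (\int[leb]_(x in A) (f x)%:E)%E.
Hypothesis bF : bounded_measurable F.
Hypothesis F_lip : forall x y, `|F x - F y| <= C * `|x - y|.
Hypothesis fF : forall t, 0 <= t -> f t = F t.
Hypothesis mu_eq : forall A, measurable A -> A `<=` nneg -> mu A = mu1 A.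
Hypothesis mu_conv_eq : forall A, measurable A -> A `<=` nneg ->
  mconvpow mu 2 A = mconvpow mu1 2 A.

Let mneg : measurable neg. Proof. exact: measurable_itv. Qed.

Lemma integrable_indic (m : probability R R) (A : set R) : measurable A ->
  m.-integrable setT (EFin \o (\1_A : R -> R)).
Proof.
move=> mA; apply: measurable_bounded_integrable => //.
- exact: le_lt_trans (probability_le1 _ measurableT) (ltry _).
- exists 1; split => // M M1 x _; rewrite /= indicE.
  by case: (_ \in _); rewrite ?normr1 ?normr0; apply: ltW => //; apply: lt_trans M1.
Qed.

Let mopp : measurable_fun setT (-%R : R -> R).
Proof. exact: oppr_measurable. Qed.

(** For y < 0 <= t the translated interval starts at t - y > 0, where the density of [mu] is [F]. *)
Let avg_le t e y : 0 <= t -> 0 < e -> y < 0 ->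
  `|fine (mu (shift_set `[t, (t + e)%R] y)) - e * F (t - y)| <= C * e * e.
Proof.
move=> t0 e0 y0.
have -> : shift_set `[t, (t + e)%R] y = `[(t - y)%R, (t - y + e)%R]%classic.
  apply/seteqP; split=> x; rewrite /shift_set /= inE /= !in_itv /= => /andP[h1 h2];
    by apply/andP; split; lra.
rewrite mu_density; last exact: measurable_itv.
have -> : (\int[leb]_(x in `[(t - y)%R, (t - y + e)%R]) (f x)%:E =
           \int[leb]_(x in `[(t - y)%R, (t - y + e)%R]) (F x)%:E)%E.
  apply: eq_integral => x; rewrite inE /= in_itv /= => /andP[h1 h2].
  by rewrite fF //; lra.
by apply: Rintegral_lipschitz_le => //; have [] := bF.
Qed.

(** The preceding estimate is integrated over y < 0 against [m], whose total mass is 1. *)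
Let wint_avg_le (m : probability R R) t e : 0 <= t -> 0 < e ->
  `|\int[m]_y (fine (mu (shift_set `[t, (t + e)%R] y)) * \1_neg y) -
    e * wint m -%R \1_neg (fun x => F (t + x))| <= C * e * e.
Proof.
move=> t0 e0; set psi := fun y => fine (mu (shift_set `[t, (t + e)%R] y)).
have mI : measurable (`[t, (t + e)%R]%classic : set R) by exact: measurable_itv.
have bpsi : bounded_measurable psi.
  split.
    apply: measurableT_comp => //; exact: measurable_measure_shift.
  exists 1 => y; rewrite ger0_norm ?fine_ge0 // -lee_fin fineK.
    by apply: probability_le1; exact: measurable_shift_set.
  by apply: fin_num_measure; exact: measurable_shift_set.
have i1 : m.-integrable setT (EFin \o (fun y => psi y * \1_neg y)).
  exact: (@integrable_wint _ _ _ m idfun \1_neg (@measurable_id _ _ _) (integrable_indic m _ mneg) psi bpsi).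
have i2 : m.-integrable setT (EFin \o (fun y => F (t - y) * \1_neg y)).
  apply: (@integrable_wint _ _ _ m -%R \1_neg mopp (integrable_indic m _ mneg) (fun x => F (t + x))).
  exact: bounded_measurable_shift.
have i3 : m.-integrable setT (EFin \o (fun y => e * (F (t - y) * \1_neg y))).
  exact: (integrableZl measurableT e i2).
rewrite /wint -RintegralZl // -RintegralB //.
rewrite (le_trans (le_normr_Rintegral _ _)) //; first exact: integrableB_EFin.
have mT : fine (m setT) = 1 by rewrite probability_setT.
apply: (@le_trans _ _ (\int[m]_y cst (C * e * e) y)); last first.
  by rewrite Rintegral_cst // mT mulr1.
apply: le_Rintegral => //.
- by apply: integrable_norm; exact: integrableB_EFin.
- exact: finite_measure_integrable_cst.
- move=> y _; rewrite mulrA -mulrBl indicE; case: (boolP (y \in _)) => yneg /=.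
    rewrite mulr1; apply: avg_le => //; by move: yneg; rewrite inE /= in_itv.
  have C0 : 0 <= C.
    by have := le_trans (normr_ge0 _) (F_lip 1 0); rewrite subr0 normr1 mulr1.
  by rewrite mulr0 normr0 !mulr_ge0 // (ltW e0).
Qed.

(** Equality of the mixed terms for A = [t, t + e] gives both integrals, multiplied by e, a common
    approximation up to C e^2; then divide by e and let e tend to 0. *)
Lemma wint_neg_eq t : 0 <= t ->
  wint mu -%R \1_neg (fun x => F (t + x)) = wint mu1 -%R \1_neg (fun x => F (t + x)).
Proof.
move=> t0.
have key e : 0 < e -> e * `|wint mu -%R \1_neg (fun x => F (t + x)) -
    wint mu1 -%R \1_neg (fun x => F (t + x))| <= e * (2 * C * e).
  move=> e0.
  have mI : measurable (`[t, (t + e)%R]%classic : set R) by exact: measurable_itv.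
  have A0 : `[t, (t + e)%R]%classic `<=` nneg.
    by move=> x /=; rewrite !in_itv /= andbT => /andP[? _]; lra.
  have indicM (m : probability R R) :
     \int[m]_y (fine (mu (shift_set `[t, (t + e)%R] y)) * \1_neg y) =
     fine (\int[m]_(y in neg) mu (shift_set `[t, (t + e)%R] y))%E.
    rewrite /Rintegral; congr fine; rewrite [RHS]integral_mkcond.
    apply: eq_integral => y _.
    rewrite patchE indicE; case: ifPn => _ /=; rewrite ?mulr1 ?mulr0 // fineK //.
    by apply: fin_num_measure; exact: measurable_shift_set.
  have J : \int[mu]_y (fine (mu (shift_set `[t, (t + e)%R] y)) * \1_neg y) =
     \int[mu1]_y (fine (mu (shift_set `[t, (t + e)%R] y)) * \1_neg y).
    by rewrite !indicM (@integral_neg_shift_eq _ mu mu1).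
  have h1 := wint_avg_le mu t e t0 e0; have h2 := wint_avg_le mu1 t e t0 e0.
  rewrite -{1}[e](gtr0_norm e0) -normrM.
  move: h1 h2; rewrite -J.
  move: (wint mu _ _ _) (wint mu1 _ _ _) (Rintegral _ _ _) => a b c h1 h2.
  have -> : e * (a - b) = (c - e * b) - (c - e * a) by ring.
  by rewrite (le_trans (ler_normB _ _)) // (le_trans (lerD h2 h1)) //; lra.
apply/eqP; rewrite -subr_eq0 -normr_le0; apply/ler_addgt0Pr => e e0; rewrite add0r.
have C0 : 0 <= C.
  by have := le_trans (normr_ge0 _) (F_lip 1 0); rewrite subr0 normr1 mulr1.
(* With this interval length the bound 2 C e / (2 C + 1) is at most [e], even when C = 0. *)
have d0 : 0 < e / (2 * C + 1) by rewrite divr_gt0 //; lra.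
have := key _ d0; rewrite ler_pM2l // => /le_trans; apply.
by rewrite mulrA ler_pdivrMr; lra.
Qed.

End negative_part.

(** * The hypotheses on k in terms of moment bounds and phases *)

Section fourier_hypotheses.
Context {R : realType}.
Variables (kr ki : R -> R).
Notation leb := (@lebesgue_measure R).
Hypotheses (mkr : measurable_fun setT kr) (mki : measurable_fun setT ki).

Let kappa (u : R) := Num.sqrt (kr u ^+ 2 + ki u ^+ 2).

(** Finiteness of every moment and of the upper limit of M_n / n! gives one constant valid for all
    n. *)
Lemma moments_le_abs_moment :
  (forall n : nat, (abs_moment kr ki n < +oo)%E) ->
  (limn_esup (fun n : nat => abs_moment kr ki n * ((n`!)%:R^-1)%:E) < +oo)%E ->
  exists C : R, moments_le kappa C.
Proof.
move=> my limy.
have m0 n : (0 <= abs_moment kr ki n)%E.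
  by apply: integral_ge0 => u _; rewrite lee_fin mulr_ge0 // ?exprn_ge0 // sqrtr_ge0.
have f0 (n : nat) : 0 < (n`!)%:R^-1 :> R by rewrite invr_gt0 ltr0n fact_gt0.
have [] := limn_esup_lty_bounded _ _ _ limy.
- by move=> n; rewrite mule_ge0 // lee_fin ltW.
- by move=> n; rewrite lte_mul_pinfty // ?ge0_fin_numE //; exact: ltry.
move=> C hC; exists C; split.
  apply: (@measurableT_comp _ _ _ _ _ _ (@Num.sqrt R)).
    by apply: continuous_measurable_fun; exact: sqrt_continuous.
  by apply: measurable_funD; exact: measurable_funX.
move=> n; have := hC n.
have -> : (\int[leb]_u (`|u| ^+ n * `|kappa u|)%:E)%E = abs_moment kr ki n.
  by apply: eq_integral => u _; rewrite [`|kappa u|]ger0_norm // sqrtr_ge0.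
have mfin : abs_moment kr ki n \is a fin_num by rewrite ge0_fin_numE.
by rewrite -[abs_moment kr ki n]fineK // -EFinM !lee_fin ler_pdivrMr.
Qed.

Lemma normr_le_sqrtD (x y : R) : `|x| <= `|Num.sqrt (x ^+ 2 + y ^+ 2)|.
Proof.
rewrite [leRHS]ger0_norm ?sqrtr_ge0 // -sqrtr_sqr ler_wsqrtr //.
by rewrite lerDl sqr_ge0.
Qed.

Hypotheses (ikr : leb.-integrable setT (EFin \o kr))
           (iki : leb.-integrable setT (EFin \o ki)).

Let mid : measurable_fun setT (@idfun R) := @measurable_id _ _ _.

Let ic (k : R -> R) (t a : R) : leb.-integrable setT (EFin \o k) ->
  leb.-integrable setT (EFin \o (fun u => cos (t * u + a) * k u)).
Proof.
move=> ik; apply: (@integrable_wint _ _ _ leb idfun k mid ik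
  (fun u => cos (t * u + a))).
exact: bounded_measurable_cos.
Qed.

Lemma fourier_reE t : fine (fourier_re kr ki t) = phase_fourier kr ki 0 t.
Proof.
rewrite /phase_fourier /cwint /wint -RintegralD //; [|exact: ic|exact: ic].
apply: eq_Rintegral => u _ /=.
by rewrite add0r addr0 cosDpihalf (mulrC t) mulNr.
Qed.

Lemma fourier_imE t : fine (fourier_im kr ki t) = phase_fourier kr ki (- (pi / 2)) t.
Proof.
rewrite /phase_fourier /cwint /wint -RintegralD //; [|exact: ic|exact: ic].
apply: eq_Rintegral => u _ /=.
by rewrite addNr addr0 cosBpihalf (mulrC t).
Qed.

Lemma bounded_measurable_phase_fourier a : bounded_measurable (phase_fourier kr ki a).
Proof.
apply: (bounded_measurableD (cwint leb idfun kr ^~ a) (cwint leb idfun ki ^~ (a + pi / 2)));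
  exact: bounded_measurable_cwint.
Qed.

End fourier_hypotheses.

(** * Deduction of the five conclusions from analyticity and injectivity *)

Theorem theorem3p9 (R : realType) (mu : probability R R) (f : R -> R)
  (kr ki : R -> R) :
  measurable_fun setT f ->
  (forall x, 0 <= f x) ->
  (forall A : set R, measurable A ->
     mu A = (\int[lebesgue_measure]_(x in A) (f x)%:E)%E) ->
  ~ (msupport mu `<=` `]-oo, (0:R)%R[) ->
  measurable_fun setT kr -> measurable_fun setT ki ->
  (forall t : R, 0 <= t ->
     fourier_re kr ki t = (f t)%:E /\ fourier_im kr ki t = 0%E) ->
  (forall n : nat, (abs_moment kr ki n < +oo)%E) ->
  (limn_esup (fun n : nat => abs_moment kr ki n * ((n`!)%:R^-1)%:E) < +oo)%E ->
  (forall a b : R, a < b ->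
     ~ {ae lebesgue_measure, forall u : R, u \in `]a, b[ ->
          kr u = 0 /\ ki u = 0}) ->
  [/\ (exists M : R, forall t : R, 0 <= t -> `|f t| <= M),
      (forall g : R -> R,
         lebesgue_measure.-integrable `[(0:R)%R, +oo[ (EFin \o g) ->
         (forall t : R, 0 <= t ->
            (\int[lebesgue_measure]_(s in `[(0:R)%R, +oo[) (f (t + s) * g s)%:E)%E = 0%E) ->
         {ae lebesgue_measure, forall s : R, s \in `[(0:R)%R, +oo[ -> g s = 0}),
      (forall mu1 : probability R R,
         (forall A : set R, measurable A -> A `<=` `[(0:R)%R, +oo[ ->
            mu1 A = mu A /\ mconvpow mu1 2 A = mconvpow mu 2 A) ->
         forall A : set R, measurable A -> mu1 A = mu A),
      classC mu &
      real_analytic (fun t => fine (fourier_re kr ki t)) /\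
      real_analytic (fun t => fine (fourier_im kr ki t))].
Proof.
move=> mf f0 mu_density _ mkr mki fE my limy k_nv.
have [C kappaC] := moments_le_abs_moment kr ki mkr mki my limy.
have krC : moments_le kr (1 * C).
  apply: (moments_le_dominated _ _ 1 C _ _ _ kappaC) => // u.
  by rewrite mul1r normr_le_sqrtD.
have kiC : moments_le ki (1 * C).
  apply: (moments_le_dominated _ _ 1 C _ _ _ kappaC) => // u.
  by rewrite mul1r addrC normr_le_sqrtD.
have ikr := moments_le_integrable0 _ _ krC.
have iki := moments_le_integrable0 _ _ kiC.
pose F := phase_fourier kr ki 0.
have tb a : taylor_bounded (phase_fourier kr ki a).
  exact: taylor_boundedD _ _ (taylor_bounded_fourier _ _ a krC)
   (taylor_bounded_fourier _ _ (a + pi / 2) kiC).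
have bF : bounded_measurable F by exact: bounded_measurable_phase_fourier.
have fF t : 0 <= t -> f t = F t.
  by move=> t0; rewrite /F -fourier_reE //; have [-> _] := fE t t0.
have F_im t : 0 <= t -> phase_fourier kr ki (- (pi / 2)) t = 0.
  by move=> t0; rewrite -fourier_imE //; have [_ ->] := fE t t0.
have wint_inj d (T : measurableType d) (nu1 nu2 : {sigma_finite_measure set T -> \bar R})
    (rho w1 w2 : T -> R) := @wint_indic_eq d T R nu1 nu2 rho w1 w2 kr ki
    (fun u => Num.sqrt (kr u ^+ 2 + ki u ^+ 2)) C.
have k_le1 u : `|kr u| <= `|Num.sqrt (kr u ^+ 2 + ki u ^+ 2)|.
  exact: normr_le_sqrtD.
have k_le2 u : `|ki u| <= `|Num.sqrt (kr u ^+ 2 + ki u ^+ 2)|.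
  by rewrite addrC normr_le_sqrtD.
have mneg : measurable (`]-oo, (0 : R)%R[%classic : set R) by exact: measurable_itv.
have mnneg : measurable (`[(0 : R)%R, +oo[%classic : set R) by exact: measurable_itv.
have unique2 (mu1 : probability R R) :
    (forall A : set R, measurable A -> A `<=` `[(0:R)%R, +oo[ ->
       mu1 A = mu A /\ mconvpow mu1 2 A = mconvpow mu 2 A) ->
    forall A : set R, measurable A -> mu1 A = mu A.
  move=> mu1E.
  have [L F_lip] := taylor_bounded_lipschitz _ (tb 0).
  have negE := wint_neg_eq mu mu1 f F L mu_density bF F_lip fF
    (fun A mA A0 => esym (mu1E A mA A0).1) (fun A mA A0 => esym (mu1E A mA A0).2).
  have mopp : measurable_fun setT (-%R : R -> R) by exact: oppr_measurable.
  (* Injectivity is applied to the restrictions of [mu] and [mu1] to ]-oo, 0[, reflected onto ]0,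
     oo[. *)
  have indicE0 := wint_inj _ _ mu mu1 -%R \1_(`]-oo, (0 : R)%R[%classic)
    \1_(`]-oo, (0 : R)%R[%classic) mopp (integrable_indic mu _ mneg)
    (integrable_indic mu1 _ mneg) mkr mki kappaC k_le1 k_le2 _ k_nv.
  have {}indicE0 A : measurable A ->
     wint mu -%R \1_(`]-oo, (0 : R)%R[%classic) \1_A =
     wint mu1 -%R \1_(`]-oo, (0 : R)%R[%classic) \1_A.
    apply: indicE0 => a t a_phase t0; case: a_phase => ->; first exact: negE.
    (* At phase - pi / 2 both sides vanish: t - s > 0 for s < 0, and the imaginary part of the
       transform of k is zero on [0, oo[. *)
    have im0 (m : probability R R) : wint m -%R \1_(`]-oo, (0 : R)%R[%classic)
        (fun x => phase_fourier kr ki (- (pi / 2)) (t + x)) = 0.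
      rewrite /wint (_ : (fun s => _) = cst 0); first by rewrite Rintegral_cst // mul0r.
      apply/funext => s; rewrite indicE mem_setE in_itv /=.
      by case: ltP => s0; rewrite ?mulr0 // F_im ?mul0r //; lra.
    by rewrite !im0.
  have negA (A : set R) : measurable A -> A `<=` `]-oo, (0 : R)%R[ -> mu1 A = mu A.
    move=> mA A0.
    have mA' : measurable (-%R @^-1` A : set R).
      by rewrite -[X in measurable X]setTI; exact: mopp.
    (* Testing the reflected measure on - A recovers the mass of [A]. *)
    have wE (m : probability R R) : wint m -%R \1_(`]-oo, (0 : R)%R[%classic) \1_(-%R @^-1` A) = fine (m A).
      rewrite /wint /Rintegral -[in RHS](setIT A) -integral_indic //; congr fine.
      apply: eq_integral => s _; congr (_ %:E); rewrite !indicE.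
      have -> : (- s \in (-%R @^-1` A : set R)) = (s \in A).
        by apply/idP/idP; rewrite !inE /= opprK.
      have [sA|sA] := boolP (s \in A); rewrite ?mul0r // mul1r.
      by rewrite mem_set //; apply: A0; rewrite inE in sA.
    have := indicE0 _ mA'; rewrite !wE => e.
    by rewrite -[mu1 A]fineK ?fin_num_measure // -e fineK ?fin_num_measure.
  move=> A mA.
  have AE : A = (A `&` `]-oo, (0 : R)%R[) `|` (A `&` `[(0 : R)%R, +oo[).
    by rewrite -setIUr negU_nneg setIT.
  have mA1 : measurable (A `&` `]-oo, (0 : R)%R[) by exact: measurableI.
  have mA2 : measurable (A `&` `[(0 : R)%R, +oo[) by exact: measurableI.
  have dA : (A `&` `]-oo, (0 : R)%R[) `&` (A `&` `[(0 : R)%R, +oo[) = set0.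
    rewrite setIACA setIid; have /disj_set2P -> := @disj_neg_nneg R.
    by rewrite setI0.
  rewrite AE !measureU //; congr (_ + _)%E; first exact: negA.
  by have [] := mu1E _ mA2 (@subIsetr _ _ _).
split.
- have [_ [B hB]] := bF; exists B => t t0.
  by rewrite fF.
- move=> g ig g0.
  pose w := g \_ `[(0 : R)%R, +oo[.
  have iw : lebesgue_measure.-integrable setT (EFin \o w).
    by have /integrable_mkcond := ig => /(_ mnneg); rewrite restrict_EFin.
  have ae0 : {ae lebesgue_measure, forall x, w x = 0}.
    apply: wint_indic_ae_eq0 => // A mA.
    transitivity (wint (@lebesgue_measure R) idfun (fun=> 0) \1_A); last exact: wint_weight0.
    have i0 : (@lebesgue_measure R).-integrable setT (EFin \o (fun=> 0)).
      exact: integrable0.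
    have inj := wint_inj _ _ lebesgue_measure lebesgue_measure idfun w (fun=> 0)
      (@measurable_id _ _ _) iw i0 mkr mki kappaC k_le1 k_le2 _ k_nv.
    apply: inj => //.
    move=> a t a_phase t0; rewrite wint_weight0.
    (* Phase 0 is the assumption on [g]; phase - pi / 2 holds because the imaginary part vanishes on
       [0, oo[, where [w] is supported. *)
    case: a_phase => ->; rewrite /wint /Rintegral.
      rewrite -[RHS]/(fine 0%E) -(g0 t t0) [in RHS]integral_mkcond; congr fine.
      apply: eq_integral => s _; rewrite /w !patchE.
      case: ifPn => [|_]; last by rewrite mulr0.
      rewrite inE /= in_itv /= andbT => s0; rewrite fF //.
      by rewrite addr_ge0.
    rewrite (_ : (fun s => _) = cst 0%E); first by rewrite integral0.
    apply/funext => s; rewrite /w patchE.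
    case: ifPn => [|_]; last by rewrite mulr0.
    by rewrite inE /= in_itv /= andbT => s0; rewrite F_im ?mul0r // addr_ge0.
  apply: (@filterS _ _ (ae_filter_ringOfSetsType (@lebesgue_measure R))) ae0 => s.
  by rewrite /w patchE => + s0; rewrite mem_set.
- exact: unique2.
- move=> mu1 mu1E; apply: unique2 => A mA A0.
  (* The powers n = 1 and n = 2 supply the two equalities. *)
  by rewrite -[mu1 A]mconvpow1E // -[mu A]mconvpow1E //; split; exact: mu1E.
- split; apply: taylor_bounded_real_analytic.
    by rewrite (_ : (fun t => _) = phase_fourier kr ki 0) //; apply/funext => t; exact: fourier_reE.
  by rewrite (_ : (fun t => _) = phase_fourier kr ki (- (pi / 2))) //; apply/funext => t; exact: fourier_imE.
Qed.
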